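(* Let $T>0$ and let $(f,E_1,E_2,B)$ be a $C^1$ solution on $[0,T]$ of the RVM problem (as described in the context) such that $f(t,x,v)=0$ at $x=0$ and $x=1$. Define $$P(t):=\sup\{|v|:\ f(t,x,v)\ne0\text{ for some }x\in\Omega\},\qquad\Sigma(t):=\{x\in\Omega:\ f(t,x,v)\ne0\text{ for some }v\in\mathbb{R}^2\}.$$ If $\mathrm{spt}(f^0)\subset[\epsilon_0,1-\epsilon_0]\times\{|v|\le k_0\}$ for some $\epsilon_0,k_0>0$, then for $t\in[0,T]$ $$P(t)\le k_0+C_2t,$$ $$\mathrm{dist}(\Sigma(t),\partial\Omega)^\gamma\ \ge\ \frac{c_0}{c_0^{-1}+2k_0+C_1+3C_2t+\|\psi_{\mathrm{ext}}\|_{L^\infty([\epsilon_0,1-\epsilon_0])}},$$ where $C_2:=4(\|f^0\|_1+|\lambda|+C_1)$ and $$\begin{aligned}C_1:={}&\|E_2^0\|_{L^\infty(\Omega)}+\|E_2^b\|_{L^\infty([0,T]\times\partial\Omega)}+\|B^0\|_{L^\infty(\Omega)}+\|B^b\|_{L^\infty([0,T]\times\partial\Omega)}\\&+\tfrac14\Big[(\|f^0\|_1+|\lambda|)^2+\|E_2^0\|_{L^\infty(\Omega)}^2+\|B^0\|_{L^\infty(\Omega)}^2+4T\,\|E_2^bB^b\|_{L^\infty([0,T]\times\partial\Omega)}\Big]+\tfrac12\big\|\sqrt{1+|v|^2}\,f^0\big\|_1 .\end{aligned}$$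
   Context: Setting. $\Omega=(0,1)$; $\|\cdot\|_1$ denotes the norm of $L^1(\Omega\times\mathbb{R}^2)$; for $v=(v_1,v_2)\in\mathbb{R}^2$, $\hat v=(\hat v_1,\hat v_2)=v/\sqrt{1+|v|^2}$. The data are: a nonnegative $f^0\in C^1_0(\Omega\times\mathbb{R}^2)$ (compactly supported $C^1$), $\lambda\in\mathbb{R}$, $C^1$ functions $E_2^0,B^0$ on $\overline\Omega$, and functions $E_2^b(t,x),B^b(t,x)$, $x\in\partial\Omega=\{0,1\}$, of class $C^1$ in $t$. The external magnetic field is $B_{\mathrm{ext}}=\partial_x\psi_{\mathrm{ext}}$ with $\psi_{\mathrm{ext}}\in C^2(\Omega)$ and $|\psi_{\mathrm{ext}}(x)|\ge c_0\,\mathrm{dist}(x,\partial\Omega)^{-\gamma}-1/c_0$ for all $x\in\Omega$, for some constants $\gamma,c_0>0$. The RVM problem on $[0,T]$: $\partial_t f+\hat v_1\partial_x f+(E_1+\hat v_2\check B)\partial_{v_1}f+(E_2-\hat v_1\check B)\partial_{v_2}f=0$ with $\check B(t,x)=B(t,x)+B_{\mathrm{ext}}(x)$ for $x\in\Omega$; $\partial_tE_1=-j_1$, $\partial_xE_1=\rho$, $\partial_tE_2=-\partial_xB-j_2$, $\partial_tB=-\partial_xE_2$, with $\rho=\int_{\mathbb{R}^2}f\,dv$ and $j=(j_1,j_2)=\int_{\mathbb{R}^2}\hat v f\,dv$; initial conditions $f(0,\cdot,\cdot)=f^0$, $E_2(0,\cdot)=E_2^0$, $B(0,\cdot)=B^0$,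 $E_1(0,0)=\lambda$; boundary conditions $E_2=E_2^b$, $B=B^b$ on $\partial\Omega$. A $C^1$ solution on $[0,T]$ has $f\in C^1([0,T]\times\overline\Omega\times\mathbb{R}^2)$ and $E_1,E_2,B\in C^1([0,T]\times\overline\Omega)$. *)

(* Defs.v *)
From HB Require Import structures.
From mathcomp Require Import all_boot all_order all_algebra.
From mathcomp Require Import all_classical all_reals all_analysis.

Set Implicit Arguments.
Unset Strict Implicit.
Unset Printing Implicit Defensive.
Import Order.TTheory GRing.Theory Num.Theory numFieldNormedType.Exports.

Local Open Scope classical_set_scope.
Local Open Scope ring_scope.

(* Functions given on a subset of R^n are total functions whose values outside
   that subset are irrelevant.  A point of phase space is (x, v) : R * (R * R),
   and with time (t, x, v) : R * R * (R * R). *)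

(* The class C^1(D), for D open or for D a closed set with dense interior (the
   only uses here): f is continuous on D, is differentiable in the interior of
   D, and its partial derivatives there extend continuously to D. *)
Definition C1_on (R : realType) (V : normedModType R) (D : set V)
    (f : V -> R) : Prop :=
  [/\ {within D, continuous f},
      forall z, D° z -> differentiable f z &
      forall u : V, exists2 g : V -> R,
        {within D, continuous g} & forall z, D° z -> 'D_u f z = g z].

Section Norms.
Context {R : realType}.

(* The norm of the library on R * R is the maximum norm. *)
Definition enorm (v : R * R) : R := Num.sqrt (v.1 ^+ 2 + v.2 ^+ 2).

Definition japanese (v : R * R) : R := Num.sqrt (1 + enorm v ^+ 2).

Definition vhat1 (v : R * R) : R := v.1 / japanese v.
Definition vhat2 (v : R * R) : R := v.2 / japanese v.

Definition Omega : set R := `]0, 1[.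
Definition Omegabar : set R := `[0, 1].
Definition bdOmega : set R := [set 0; 1].
Definition phase : set (R * (R * R)) := Omega `*` setT.

Definition lebesgue2 := (@lebesgue_measure R \x @lebesgue_measure R)%E.

HB.instance Definition _ := Measure.on lebesgue2.

Lemma sigma_finite_lebesgue2 : sigma_finite [set: R * R] lebesgue2.
Proof.
have /sigma_finiteP[F [TF ndF Foo]] := sigma_finiteT (@lebesgue_measure R).
exists (fun n => F n `*` F n) => [|k].
  rewrite -setXTT TF predeqE => -[x y]; split.
    move=> [/= [n _ Fnx] [k _ Fky]]; exists (maxn n k) => //; split.
    - by move: x Fnx; exact/subsetPset/ndF/leq_maxl.
    - by move: y Fky; exact/subsetPset/ndF/leq_maxr.
  by move=> [n _ []/= ? ?]; split; exists n.
have [mF Fkoo] := Foo k; split; first exact: measurableX.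
by rewrite /lebesgue2 product_measure1E// lte_mul_pinfty// ge0_fin_numE.
Qed.

HB.instance Definition _ :=
  Measure_isSigmaFinite.Build _ _ _ lebesgue2 sigma_finite_lebesgue2.

(* The three norms below are finite for the functions they are applied to,
   which are continuous with compact support or continuous on a compact set. *)
Definition L1norm (f0 : R * (R * R) -> R) : R :=
  fine 'N[lebesgue_measure \x lebesgue2]_1[EFin \o (f0 \_ phase)%R]%E.

Definition Linfty (D : set R) (g : R -> R) : R :=
  fine 'N[@lebesgue_measure R]_+oo[EFin \o (g \_ D)%R]%E.

(* L^oo([0,T] x bdOmega), for the counting measure on the two points 0 and 1. *)
Definition Linfty_bd (T : R) (g : R -> R -> R) : R :=
  Num.max (Linfty `[0, T] (g ^~ 0)) (Linfty `[0, T] (g ^~ 1)).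

(* dist(A, bdOmega); it is +oo when A is empty. *)
Definition dist_bd (A : set R) : \bar R := ereal_inf (edist_inf bdOmega @` A).

Definition spt (f0 : R * (R * R) -> R) : set (R * (R * R)) :=
  closure [set z | phase z /\ f0 z != 0].

Definition C1_compact_support (f0 : R * (R * R) -> R) : Prop :=
  [/\ C1_on phase f0, compact (spt f0) & spt f0 `<=` phase].

End Norms.

Section RVM.
Context {R : realType}.
Implicit Types (f : R * R * (R * R) -> R) (E B : R * R -> R).

Definition rho f (t x : R) : R := (\int[lebesgue2]_v f (t, x, v))%R.
Definition j1 f (t x : R) : R := (\int[lebesgue2]_v (vhat1 v * f (t, x, v)))%R.
Definition j2 f (t x : R) : R := (\int[lebesgue2]_v (vhat2 v * f (t, x, v)))%R.

Definition Bcheck (psi_ext : R -> R) B (t x : R) : R :=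
  B (t, x) + derive1 psi_ext x.

(* (f, E1, E2, B) is a C^1 solution on [0,T].  The equations are imposed in the
   interior, where 'D_u is a partial derivative; those for the fields extend to
   the closure by continuity, while Bext is defined only on Omega. *)
Record is_C1_RVM_solution (psi_ext : R -> R) (f0 : R * (R * R) -> R) (lam : R)
    (E20 B0 : R -> R) (E2b Bb : R -> R -> R) (T : R)
    f (E1 E2 B : R * R -> R) : Prop := {
  RVM_C1_f : C1_on (`[0, T] `*` Omegabar `*` [set: R * R]) f;
  RVM_C1_E1 : C1_on (`[0, T] `*` Omegabar) E1;
  RVM_C1_E2 : C1_on (`[0, T] `*` Omegabar) E2;
  RVM_C1_B : C1_on (`[0, T] `*` Omegabar) B;
  RVM_vlasov : forall t x v, t \in `]0, T[ -> Omega x ->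
    'D_(1, 0, 0) f (t, x, v)
    + vhat1 v * 'D_(0, 1, 0) f (t, x, v)
    + (E1 (t, x) + vhat2 v * Bcheck psi_ext B t x)
        * 'D_(0, 0, (1, 0)) f (t, x, v)
    + (E2 (t, x) - vhat1 v * Bcheck psi_ext B t x)
        * 'D_(0, 0, (0, 1)) f (t, x, v) = 0;
  RVM_dtE1 : forall t x, t \in `]0, T[ -> Omega x ->
    'D_(1, 0) E1 (t, x) = - j1 f t x;
  RVM_dxE1 : forall t x, t \in `]0, T[ -> Omega x ->
    'D_(0, 1) E1 (t, x) = rho f t x;
  RVM_dtE2 : forall t x, t \in `]0, T[ -> Omega x ->
    'D_(1, 0) E2 (t, x) = - 'D_(0, 1) B (t, x) - j2 f t x;
  RVM_dtB : forall t x, t \in `]0, T[ -> Omega x ->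
    'D_(1, 0) B (t, x) = - 'D_(0, 1) E2 (t, x);
  RVM_init_f : forall x v, Omega x -> f (0, x, v) = f0 (x, v);
  RVM_init_E2 : forall x, Omegabar x -> E2 (0, x) = E20 x;
  RVM_init_B : forall x, Omegabar x -> B (0, x) = B0 x;
  RVM_init_E1 : E1 (0, 0) = lam;
  RVM_bd_E2 : forall t x, t \in `[0, T] -> bdOmega x -> E2 (t, x) = E2b t x;
  RVM_bd_B : forall t x, t \in `[0, T] -> bdOmega x -> B (t, x) = Bb t x
}.

(* Momentum and spatial supports; the supremum is -oo when f(t) vanishes. *)
Definition P f (t : R) : \bar R :=
  ereal_sup [set (enorm v)%:E | v in
               [set v | exists2 x, Omega x & f (t, x, v) != 0]].

Definition Sigma f (t : R) : set R :=
  [set x | Omega x /\ exists v, f (t, x, v) != 0].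

Definition C1const (f0 : R * (R * R) -> R) (lam : R) (E20 B0 : R -> R)
    (E2b Bb : R -> R -> R) (T : R) : R :=
  Linfty Omega E20 + Linfty_bd T E2b + Linfty Omega B0 + Linfty_bd T Bb
  + 4^-1 * ((L1norm f0 + `|lam|) ^+ 2 + Linfty Omega E20 ^+ 2
            + Linfty Omega B0 ^+ 2
            + 4 * T * Linfty_bd T (fun t x => E2b t x * Bb t x))
  + 2^-1 * L1norm (fun z => japanese z.2 * f0 z).

Definition C2const (f0 : R * (R * R) -> R) (lam : R) (E20 B0 : R -> R)
    (E2b Bb : R -> R -> R) (T : R) : R :=
  4 * (L1norm f0 + `|lam| + C1const f0 lam E20 B0 E2b Bb T).

End RVM.

(* Main.v *)
Require Import Defs.
From mathcomp Require Import all_boot all_order all_algebra.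
From mathcomp Require Import all_classical all_reals all_analysis.
From mathcomp Require Import measurable_realfun ess_sup_inf.
From mathcomp Require Import ring lra.
Import Order.TTheory GRing.Theory Num.Theory numFieldNormedType.Exports.
Set Implicit Arguments.
Unset Strict Implicit.
Unset Printing Implicit Defensive.
Local Open Scope classical_set_scope.
Local Open Scope ring_scope.

(** Bounds on the momenta and on the distance of the plasma to the walls for the
    confined relativistic Vlasov-Maxwell system on the interval.

    The density [f] is constant along the vector field
    [X = (1, vhat1, force1, force2)].  This is exploited without its integral
    curves.  Suppose that [u], equal to [f] or [- f], and a function [h] are
    both positive somewhere on a compact set.  At a maximum of [u * h] step back
    along the straight line of direction [- X]: [u] is stationary to first order,
    so if [h] decreases strictly along [X] the product increases, which is
    absurd ([no_pos_max], [transport_max_principle]).  So [h <= 0] wherever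
    [u > 0], as soon as this holds at the initial time.  Three choices of [h] are
    made.  A decreasing function of the time alone shows that [f] stays
    nonnegative.  The modulus of [v] grows at rate at most [|E1| + |E2|], since
    the magnetic force is orthogonal to [v]
    ([transport_momentum_bound]).  The canonical momentum [v2 + psi_ext] varies
    at rate [E2 - vhat1 * B], in which the external field has cancelled
    ([transport_canonical_momentum]).

    It remains to bound the fields.  [E1] is nondecreasing in [x], because its
    derivative is [rho >= 0]; its value at the left wall keeps its initial value
    [lam], because no current reaches the walls; and its increment across the
    interval is the total mass, which is therefore the initial one.  Hence
    [|E1| <= ||f0||_1 + |lam|] ([E1_bound]).

    The waves [W = E2 + sg * B], [sg = 1] or [-1], satisfy
    [dt W + sg * dx W = - j2].  The energy density [e] and the momentum density
    [m] satisfy [dt e + dx m = 0], and [|j2| <= e - sg * m] since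
    [|vhat2| <= japanese v - sg * v1].  The right-hand side is the flux of energy
    through the light ray along which [W] is transported.  Integrating, the
    variation of [W] along a ray is at most the energy on one side of it plus
    what has entered through the walls, where [m = E2 * B] is given
    ([wave_increment]).  Followed backwards, the ray ends at the initial time or
    on a wall, where [W] is given too ([wave_bound]).  So
    [|E2| + |B| <= 3 * C1] ([E2_B_bound], [C1const_ge]).

    Then [|E1| + |E2| <= C2] gives the momentum bound.  On the support both
    [v2] and [v2 + psi_ext] are bounded, hence [psi_ext] is, and the growth of
    [psi_ext] at the walls turns this into a lower bound for the distance. *)

(** * Maxima of a product of two functions *)

Lemma continuous_comp_within (X Y Z : topologicalType) (A : set Y) (f : Y -> Z)
    (c : X -> Y) :
  {within A, continuous f} -> continuous c -> (forall x, A (c x)) ->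
  continuous (f \o c).
Proof.
move=> cf cc Ac x.
have /subspace_continuousP/(_ (c x) (Ac x)) fx := cf.
apply: cvg_comp fx => U /= wU.
have /= : nbhs x (c @^-1` [set y | A y -> U y]) by exact: (cc x).
by apply: filterS => y /= /(_ (Ac y)).
Qed.

Lemma is_derive_gt0_right (R : realType) (phi : R -> R) (s0 d : R) :
  is_derive s0 (1:R) phi d -> 0 < d -> \forall s \near s0^'+, phi s0 < phi s.
Proof.
move=> [dphi <-] d0.
have : h^-1 *: (phi (h + s0) - phi s0) @[h --> (0:R)^'] --> 'D_1 phi s0.
  have := dphi; rewrite /derivable /derive.
  by under eq_fun do rewrite /= [_ *: 1]mulr1.
move=> /cvgr_gt /(_ _ d0).
rewrite /at_right !near_withinE => -[e /= e0 He].
exists e => //= s; rewrite /ball/= => se s0s.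
have := He (s - s0); rewrite /= sub0r normrN distrC => /(_ se).
rewrite subr_eq0 gt_eqF// subrK => /(_ isT).
by rewrite [_ *: _]mulrC pmulr_lgt0 ?invr_gt0 ?subr_gt0.
Qed.

Lemma is_derive_continuous (R : realType) (phi : R -> R) (s0 d : R) :
  is_derive s0 (1:R) phi d -> phi s @[s --> s0] --> phi s0.
Proof. by move=> [/derivable1_diffP/differentiable_continuous]. Qed.

Lemma closed_superlevel (R : realType) (V : topologicalType) (u : V -> R) (a : R) :
  continuous u -> closed [set z | a <= u z].
Proof.
by move=> cu; apply: (@closed_comp _ _ u [set y | a <= y]) => //; exact: closed_ge.
Qed.

(** A positive maximum of [u * h] is impossible when each point where both factors
    are positive is the origin of a curve in [K] along which [u] is stationary and
    [h] has positive derivative.  Continuity of [h] is asked only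
    where [u] is positive: [h] may be singular elsewhere, as long as it stays
    bounded above, for the maximum lies where [u] is bounded below. *)
Lemma no_pos_max (R : realType) (V : topologicalType) (K : set V) (u h : V -> R) (M : R) :
  compact K -> continuous u -> 0 < M -> (forall z, K z -> h z <= M) ->
  (forall z, K z -> 0 < u z -> {for z, continuous h}) ->
  (forall z, K z -> 0 < u z -> 0 < h z -> exists c : R -> V, exists2 d : R,
     c 0 = z /\ (\forall s \near (0:R)^'+, K (c s)) &
     [/\ 0 < d, is_derive (0:R) (1:R) (u \o c) 0 & is_derive (0:R) (1:R) (h \o c) d]) ->
  forall z, K z -> 0 < u z -> h z <= 0.
Proof.
move=> cK cu M0 hM ch H z0 Kz0 u0; rewrite leNgt; apply/negP => h0.
set w := fun z => u z * h z.
have w0 : 0 < w z0 by rewrite mulr_gt0.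
(* [w z0 <= w z] forces [a <= u z], because [h <= M] *)
set a := w z0 / M.
have a0 : 0 < a by rewrite divr_gt0.
set K' := K `&` [set z | a <= u z].
have clK : closed [set z | a <= u z] by exact: closed_superlevel.
have cK' : compact K'.
  by apply: compact_closedI.
have inK' z : K z -> w z0 <= w z -> 0 < u z -> K' z.
  move=> Kz wz uz; split => //=.
  rewrite /a ler_pdivrMr//; apply: (le_trans wz).
  by rewrite ler_wpM2l ?hM// ltW.
have K'z0 : K' z0 by exact: inK'.
have wc : {within K', continuous w}.
  move=> z; apply: continuous_in_subspaceT => {}z /set_mem [Kz /= az].
  by apply: continuousM; [exact: cu|apply: ch => //; exact: lt_le_trans az].
have [zm /set_mem [Kzm /= azm] zmax] := compact_EVT_max (ex_intro _ _ K'z0) cK' wc.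
have um : 0 < u zm by exact: lt_le_trans azm.
have wm : w z0 <= w zm by apply: zmax; exact: mem_set.
have hm : 0 < h zm.
  by move: (lt_le_trans w0 wm); rewrite /w pmulr_rgt0.
have [c [d [c0 Kc] [d0 duc dhc]]] := H _ Kzm um hm.
pose phi s := (u \o c) s * (h \o c) s.
have dphi : is_derive (0:R) (1:R) phi (u zm * d).
  have -> : u zm * d = (u \o c) 0 *: d + (h \o c) 0 *: 0.
    by rewrite /= c0 scaler0 addr0.
  exact: is_deriveM.
have dphi0 : 0 < u zm * d by rewrite mulr_gt0.
have phi_incr := @is_derive_gt0_right _ _ _ _ dphi dphi0.
have uc : (u \o c) s @[s --> (0:R)] --> u zm.
  have -> : u zm = (u \o c) 0 by rewrite /= c0.
  exact: is_derive_continuous duc.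
have uc' : \forall s \near (0:R)^'+, 0 < (u \o c) s.
  by apply: (cvgr_gt _ (cvg_at_right_filter uc)).
near (0:R)^'+ => s.
have Kcs : K (c s) by near: s.
have ucs : 0 < u (c s) by near: s.
have ws : w zm < w (c s).
  have : phi 0 < phi s by near: s.
  by rewrite /phi /= c0.
have := zmax (c s); rewrite leNgt ws => /(_ _)/negP; apply => //.
by apply/mem_set/inK' => //; exact: (le_trans wm (ltW ws)).
Unshelve. all: by end_near. Qed.

(** * Syntax-directed continuity *)

Section continuity_rules.
Context (R : realType) (X : topologicalType).
Implicit Types (f g : X -> R) (x : X).

Lemma cts_cst (Y : topologicalType) (c : Y) x : continuous_at x (fun=> c).
Proof. exact: cvg_cst. Qed.

Lemma cts_id x : continuous_at x (fun z => z).
Proof. exact: cvg_id. Qed.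

Lemma cts_comp (Y Z : topologicalType) (E : Y -> Z) (g : X -> Y) x :
  continuous_at (g x) E -> continuous_at x g -> continuous_at x (fun z => E (g z)).
Proof. by move=> cE cg; apply: (@continuous_comp _ _ _ g E). Qed.

Lemma cts_pair (Y Z : topologicalType) (f : X -> Y) (g : X -> Z) x :
  continuous_at x f -> continuous_at x g -> continuous_at x (fun z => (f z, g z)).
Proof. by move=> cf cg; exact: cvg_pair. Qed.

Lemma cts_fst (Y Z : topologicalType) (f : X -> Y * Z) x :
  continuous_at x f -> continuous_at x (fun z => (f z).1).
Proof. by move=> cf; apply: (@cvg_comp _ _ _ f fst) cf _; exact: cvg_fst. Qed.

Lemma cts_snd (Y Z : topologicalType) (f : X -> Y * Z) x :
  continuous_at x f -> continuous_at x (fun z => (f z).2).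
Proof. by move=> cf; apply: (@cvg_comp _ _ _ f snd) cf _; exact: cvg_snd. Qed.

Lemma cts_add f g x : continuous_at x f -> continuous_at x g ->
  continuous_at x (fun z => f z + g z).
Proof. by move=> cf cg; exact: cvgD. Qed.

Lemma cts_opp f x : continuous_at x f -> continuous_at x (fun z => - f z).
Proof. by move=> cf; exact: cvgN. Qed.

Lemma cts_mul f g x : continuous_at x f -> continuous_at x g ->
  continuous_at x (fun z => f z * g z).
Proof. by move=> cf cg; exact: cvgM. Qed.

Lemma cts_exp f n x : continuous_at x f -> continuous_at x (fun z => f z ^+ n).
Proof.
move=> cf; elim: n => [|n IH]; first exact: cts_cst.
by under [X in continuous_at _ X]eq_fun do rewrite exprS; exact: cts_mul.
Qed.

Lemma cts_inv f x : f x != 0 -> continuous_at x f -> continuous_at x (fun z => (f z)^-1).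
Proof. by move=> f0 cf; exact: cvgV. Qed.

Lemma cts_norm f x : continuous_at x f -> continuous_at x (fun z => `|f z|).
Proof. by move=> cf; exact: cvg_norm. Qed.

Lemma cts_sqrt f x : continuous_at x f -> continuous_at x (fun z => Num.sqrt (f z)).
Proof. by move=> cf; apply: (@cts_comp _ _ Num.sqrt f) => //; exact: sqrt_continuous. Qed.

End continuity_rules.

(** Side conditions that are not continuity statements, such as a denominator
    being nonzero, are left to the user. *)
Ltac cts_step :=
  match goal with
  | |- continuous_at _ (fun z => z) => exact: cts_id
  | |- continuous_at _ (fun=> _) => exact: cts_cst
  | |- continuous_at _ (fun z => _ + _) => apply: cts_add
  | |- continuous_at _ (fun z => - _) => apply: cts_opp
  | |- continuous_at _ (fun z => _ * _) => apply: cts_mul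
  | |- continuous_at _ (fun z => (_)^-1) => apply: cts_inv
  | |- continuous_at _ (fun z => _ ^+ _) => apply: cts_exp
  | |- continuous_at _ (fun z => `|_|) => apply: cts_norm
  | |- continuous_at _ (fun z => Num.sqrt _) => apply: cts_sqrt
  | |- continuous_at _ (fun z => (_, _)) => apply: cts_pair
  | |- continuous_at _ (fun z => (_).1) => apply: cts_fst
  | |- continuous_at _ (fun z => (_).2) => apply: cts_snd
  | |- continuous_at _ (@GRing.opp _) => exact: (cts_opp (@cts_id _ _))
  | |- continuous_at _ (GRing.add _) => exact: (cts_add (@cts_cst _ _ _ _) (@cts_id _ _))
  | |- continuous_at _ (GRing.mul _) => exact: (cts_mul (@cts_cst _ _ _ _) (@cts_id _ _))
  | |- continuous_at _ (pair _) => exact: (cts_pair (@cts_cst _ _ _ _) (@cts_id _ _))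
  | |- continuous_at _ fst => exact: (cts_fst (@cts_id _ _))
  | |- continuous_at _ snd => exact: (cts_snd (@cts_id _ _))
  | H : continuous ?E |- continuous_at _ ?E => exact: H
  | H : continuous ?E |- continuous_at _ (fun z => ?E _) =>
      apply: (@cts_comp _ _ _ E); [exact: H|]
  end.
Ltac cts := intros;
  (lazymatch goal with
   | |- {for ?x, continuous ?f} => change (continuous_at x f)
   | |- continuous ?f => let x := fresh in intro x; change (continuous_at x f)
   | _ => idtac end);
  cbv beta; repeat cts_step.
(** * Extension of C1 functions from a closed domain *)

Lemma is_derive_line (R : realType) (V W : normedModType R) (f : V -> W)
    (c : R -> V) (s0 : R) (u : V) (d : W) :
  is_derive (c s0) u f d -> (forall h, c (h + s0) = h *: u + c s0) ->
  is_derive s0 (1:R) (f \o c) d.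
Proof.
move=> [df <-] cE.
have E : (fun h : R => h^-1 *: (((f \o c) \o shift s0) (h *: 1) - (f \o c) s0)) =
         (fun h : R => h^-1 *: ((f \o shift (c s0)) (h *: u) - f (c s0))).
  by apply/funext => h /=; rewrite -cE [h *: 1]mulr1.
by apply: DeriveDef; rewrite /derivable /derive E.
Qed.

(** The one-sided regularity on [D] becomes continuity on the whole space after
    composition with a retraction onto [D]; nothing changes in the interior, where
    the derivatives are taken.  This frees everything that follows from
    continuity within a set. *)
Lemma C1_on_retract (R : realType) (V : normedModType R) (D : set V)
    (f : V -> R) (r : V -> V) :
  C1_on D f -> continuous r -> (forall z, D (r z)) -> {in D, forall z, r z = z} ->
  exists2 G : V -> V -> R, continuous (f \o r) /\ (forall u, continuous (G u)) &
    forall z, D° z -> [/\ forall u, is_derive z u (f \o r) (G u z),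
      forall u, 'D_u f z = G u z,
      forall u w, G (u + w) z = G u z + G w z &
      forall a u, G (a *: u) z = a * G u z].
Proof.
move=> [fc fd fp] rc rD rid.
have /choice[g Hg] : forall u, exists g : V -> R,
    {within D, continuous g} /\ forall z, D° z -> 'D_u f z = g z.
  by move=> u; have [g g1 g2] := fp u; exists g.
have DD z : D° z -> D z by exact: interior_subset.
exists (fun u => g u \o r).
  split; first exact: continuous_comp_within rc rD.
  by move=> u; apply: continuous_comp_within rc rD; have [] := Hg u.
move=> z Dz; have rz : r z = z by apply/rid/mem_set/DD.
have gE u : (g u \o r) z = 'd f z u.
  by rewrite /= rz; have [_ <- //] := Hg u; rewrite deriveE//; exact: fd.
split=> [u|u|u w|a u]; last 3 first.
- by rewrite gE deriveE//; exact: fd.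
- by rewrite !gE linearD.
- by rewrite !gE linearZ.
have H : is_derive z u f ((g u \o r) z).
  apply: DeriveDef; first exact/diff_derivable/fd.
  by rewrite gE deriveE//; exact: fd.
have fr : \forall y \near z, f y = (f \o r) y.
  by near=> y; rewrite /= rid//; apply/mem_set; near: y.
exact: near_eq_is_derive H.
Unshelve. all: by end_near. Qed.

Definition clamp (R : realType) (a b x : R) : R := Num.max a (Num.min b x).

Section clamp.
Context (R : realType).
Implicit Types a b x : R.

Lemma clamp_continuous a b : continuous (clamp a b).
Proof.
move=> x; apply: continuous_max; first exact: cvg_cst.
by apply: continuous_min; [exact: cvg_cst|exact: cvg_id].
Qed.

Lemma clamp_itv a b x : a <= b -> clamp a b x \in `[a, b].
Proof.
by move=> ab; rewrite in_itv/= le_max lexx/= ge_max ab/= ge_min lexx.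
Qed.

Lemma clamp_id a b x : x \in `[a, b] -> clamp a b x = x.
Proof.
by rewrite in_itv/= => /andP[ax xb]; rewrite /clamp (min_idPr xb) (max_idPr ax).
Qed.

End clamp.

(** The differential at an interior point is recorded through its values along all
    lines, the only form in which it is used.  [E] and its partial derivatives
    [Et], [Ex] are continuous on the whole plane, where they stand for extensions
    of functions that matter on the rectangle of sides [0,T] and [0,1]. *)
Definition C1_rect (R : realType) (T : R) (E Et Ex : R * R -> R) : Prop :=
  [/\ continuous E, continuous Et, continuous Ex &
   forall t x a b, t \in `]0, T[ -> Omega x ->
    is_derive (0:R) (1:R) (fun s => E (t + s * a, x + s * b))
      (a * Et (t, x) + b * Ex (t, x))].

Definition C1_phase (R : realType) (T : R) (f ft fx f1 f2 : R * R * (R * R) -> R) : Prop :=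
  [/\ continuous f, continuous ft, continuous fx, continuous f1 & continuous f2] /\
   forall t x v1 v2 a b c d, t \in `]0, T[ -> Omega x ->
    is_derive (0:R) (1:R)
      (fun s => f (t + s * a, x + s * b, (v1 + s * c, v2 + s * d)))
      (a * ft (t, x, (v1, v2)) + b * fx (t, x, (v1, v2)) +
       c * f1 (t, x, (v1, v2)) + d * f2 (t, x, (v1, v2))).

Definition clamp_rect (R : realType) (T : R) (p : R * R) : R * R :=
  (clamp 0 T p.1, clamp 0 1 p.2).

Section extension.
Context (R : realType) (T : R).
Hypothesis T0 : 0 < T.

Lemma clamp_rect_continuous : continuous (@clamp_rect R T).
Proof.
rewrite /clamp_rect; have cT := @clamp_continuous R 0 T; have c1 := @clamp_continuous R 0 1.
cts.
Qed.

Lemma clamp_rect_in p : (`[0, T] `*` @Omegabar R) (clamp_rect T p).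
Proof. by split => /=; apply: clamp_itv => //; exact: ltW. Qed.

Lemma clamp_rect_id t x : t \in `[0, T] -> Omegabar x -> clamp_rect T (t, x) = (t, x).
Proof. by move=> tT x1; rewrite /clamp_rect/= !clamp_id. Qed.

Lemma rect_interior t x : t \in `]0, T[ -> Omega x ->
  (`[0, T] `*` @Omegabar R)° (t, x).
Proof.
move=> tT x1; exists (`]0, T[%classic, `]0, 1[%classic) => /=.
  by split; apply: open_nbhs_nbhs; split => //; exact: interval_open.
by move=> [s y] /= [? ?]; split; exact: subset_itv_oo_cc.
Qed.

Lemma C1_on_rect (E : R * R -> R) :
  C1_on (`[0, T] `*` @Omegabar R) E ->
  exists Et Ex, C1_rect T (E \o clamp_rect T) Et Ex /\
    forall t x, t \in `]0, T[ -> Omega x ->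
    'D_(1, 0) E (t, x) = Et (t, x) /\ 'D_(0, 1) E (t, x) = Ex (t, x).
Proof.
move=> EC.
have rid : {in `[0, T] `*` @Omegabar R, forall z, clamp_rect T z = z}.
  by move=> [t x] /set_mem[/= tT x1]; exact: clamp_rect_id.
have [G [Ec Gc] HG] := C1_on_retract EC clamp_rect_continuous clamp_rect_in rid.
exists (G (1, 0)), (G (0, 1)); split; last first.
  by move=> t x tT x1; have [_ GE _ _] := HG _ (rect_interior tT x1); rewrite !GE.
split => // t x a b tT x1.
have [dE _ GD GZ] := HG _ (rect_interior tT x1).
have -> : a * G (1, 0) (t, x) + b * G (0, 1) (t, x) = G (a, b) (t, x).
  rewrite -!GZ -GD; congr (G _ _); apply: injective_projections => /=.
    by rewrite [_ *: _]mulr1 scaler0 addr0.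
  by rewrite scaler0 [_ *: _]mulr1 add0r.
apply: (@is_derive_line _ _ _ (E \o clamp_rect T) (fun s => (t + s * a, x + s * b)) 0 (a, b)).
  by rewrite !mul0r !addr0; exact: dE.
by move=> h; congr pair; rewrite /= addr0 mul0r addr0 addrC.
Qed.

Definition clamp_phase (z : R * R * (R * R)) : R * R * (R * R) := (clamp_rect T z.1, z.2).

Lemma C1_on_phase (f : R * R * (R * R) -> R) :
  C1_on (`[0, T] `*` @Omegabar R `*` setT) f ->
  exists ft fx f1 f2, C1_phase T (f \o clamp_phase) ft fx f1 f2 /\
    forall t x v, t \in `]0, T[ -> Omega x ->
    [/\ 'D_(1, 0, 0) f (t, x, v) = ft (t, x, v),
        'D_(0, 1, 0) f (t, x, v) = fx (t, x, v),
        'D_(0, 0, (1, 0)) f (t, x, v) = f1 (t, x, v) &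
        'D_(0, 0, (0, 1)) f (t, x, v) = f2 (t, x, v)].
Proof.
move=> fC; set D := (X in C1_on X) in fC.
have rid : {in D, forall z, clamp_phase z = z}.
  by move=> [[t x] v] /set_mem[[/= tT x1] _]; rewrite /clamp_phase /= clamp_rect_id.
have rc : continuous clamp_phase.
  by rewrite /clamp_phase; have cc := clamp_rect_continuous; cts.
have rD z : D (clamp_phase z) by split => //; exact: clamp_rect_in.
have inD t x v : t \in `]0, T[ -> Omega x -> D° (t, x, v).
  move=> tT x1; exists (`[0, T] `*` @Omegabar R, setT) => //=.
  by split; [exact: rect_interior|exact: filterT].
have [G [fc Gc] HG] := C1_on_retract fC rc rD rid.
exists (G (1, 0, 0)), (G (0, 1, 0)), (G (0, 0, (1, 0))), (G (0, 0, (0, 1))); split; last first.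
  by move=> t x v tT x1; have [_ GE _ _] := HG _ (inD _ _ v tT x1); rewrite !GE.
split => // t x v1 v2 a b c d tT x1.
have [df _ GD GZ] := HG _ (inD _ _ (v1, v2) tT x1).
rewrite -!GZ -!GD.
have -> : a *: (1, 0, 0) + b *: (0, 1, 0) + c *: (0, 0, (1, 0)) + d *: (0, 0, (0, 1))
   = (a, b, (c, d)) :> R * R * (R * R).
  apply: injective_projections; apply: injective_projections => /=;
    by rewrite ?scaler0 ?[_ *: 1]mulr1 ?(addr0, add0r).
apply: (@is_derive_line _ _ _ (f \o clamp_phase)
   (fun s => (t + s * a, x + s * b, (v1 + s * c, v2 + s * d))) 0 (a, b, (c, d))).
  by rewrite !mul0r !addr0; exact: df.
by move=> h; congr (_, _, (_, _)); rewrite /= addr0 mul0r addr0 addrC.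
Qed.

End extension.

(** * Syntax-directed derivatives *)

Section derivative_rules.
Context (R : realType).
Implicit Types (f g : R -> R) (x : R).

Lemma der_eq f x df df' :
  is_derive x (1:R) f df -> df = df' -> is_derive x (1:R) f df'.
Proof. by move=> Df <-. Qed.

Lemma der_cst (c x : R) : is_derive x (1:R) (fun=> c) 0.
Proof. exact: is_derive_cst. Qed.

Lemma der_id x : is_derive x (1:R) (fun z => z) 1.
Proof. exact: is_derive_id. Qed.

Lemma der_add f g x df dg : is_derive x (1:R) f df -> is_derive x (1:R) g dg ->
  is_derive x (1:R) (fun z => f z + g z) (df + dg).
Proof. by move=> Df Dg; exact: is_deriveD. Qed.

Lemma der_opp f x df : is_derive x (1:R) f df ->
  is_derive x (1:R) (fun z => - f z) (- df).
Proof. by move=> Df; exact: is_deriveN. Qed.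

Lemma der_mul f g x df dg : is_derive x (1:R) f df -> is_derive x (1:R) g dg ->
  is_derive x (1:R) (fun z => f z * g z) (f x * dg + g x * df).
Proof. by move=> Df Dg; exact: is_deriveM. Qed.

Lemma der_sqr f x df : is_derive x (1:R) f df ->
  is_derive x (1:R) (fun z => f z ^+ 2) (2 * f x * df).
Proof.
move=> Df; apply: (is_derive_eq (der_mul Df Df)); ring.
Qed.

Lemma der_comp (F f : R -> R) x dF df : is_derive (f x) (1:R) F dF ->
  is_derive x (1:R) f df -> is_derive x (1:R) (fun z => F (f z)) (dF * df).
Proof. by move=> DF Df; apply: (is_derive_eq (@is_derive1_comp _ F f _ _ _ _ _)). Qed.

Lemma der_sqrt f x df : 0 < f x -> is_derive x (1:R) f df ->
  is_derive x (1:R) (fun z => Num.sqrt (f z)) ((2 * Num.sqrt (f x))^-1 * df).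
Proof. by move=> f0; apply: der_comp; exact: is_derive1_sqrt. Qed.

End derivative_rules.

Ltac der_step :=
  match goal with
  | H : is_derive ?x _ ?f _ |- is_derive ?x _ ?f _ => exact: H
  | |- is_derive _ _ (fun z => z) _ => exact: der_id
  | |- is_derive _ _ (fun=> _) _ => exact: der_cst
  | |- is_derive _ _ (fun z => _ + _) _ => notypeclasses refine (der_add _ _)
  | |- is_derive _ _ (fun z => - _) _ => notypeclasses refine (der_opp _)
  | |- is_derive _ _ (fun z => _ * _) _ => notypeclasses refine (der_mul _ _)
  | |- is_derive _ _ (fun z => _ ^+ 2) _ => notypeclasses refine (der_sqr _)
  | |- is_derive _ _ (fun z => Num.sqrt _) _ => notypeclasses refine (der_sqrt _ _)
  | |- is_derive _ _ (@GRing.opp _) _ => exact: (der_opp (der_id _))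
  | |- is_derive _ _ (GRing.add ?c) _ => exact: (der_add (der_cst c _) (der_id _))
  | |- is_derive _ _ (GRing.mul ?c) _ => exact: (der_mul (der_cst c _) (der_id _))
  | |- is_derive _ _ _ _ => eassumption
  end.
(* Leaves the comparison of the computed derivative with the expected one. *)
Ltac der := notypeclasses refine (der_eq _ _); [repeat der_step|].
(** * Relativistic velocities *)

Section kinematics.
Context (R : realType).
Implicit Types v : R * R.

Lemma japaneseE v : japanese v = Num.sqrt (1 + v.1 ^+ 2 + v.2 ^+ 2).
Proof. by rewrite /japanese /enorm sqr_sqrtr ?addr_ge0 ?sqr_ge0// addrA. Qed.

Lemma japanese_sqr v : japanese v ^+ 2 = 1 + v.1 ^+ 2 + v.2 ^+ 2.
Proof. by rewrite japaneseE sqr_sqrtr// !addr_ge0 ?sqr_ge0. Qed.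

Lemma japanese_ge1 v : 1 <= japanese v.
Proof.
rewrite -(@ler_pXn2r _ 2)// ?nnegrE// ?sqrtr_ge0// japanese_sqr.
by rewrite expr1n -addrA lerDl addr_ge0 ?sqr_ge0.
Qed.

Lemma japanese_gt0 v : 0 < japanese v.
Proof. exact: lt_le_trans ltr01 (japanese_ge1 v). Qed.

Lemma japanese_continuous : continuous (@japanese R).
Proof.
by have -> : @japanese R = (fun v => Num.sqrt (1 + v.1 ^+ 2 + v.2 ^+ 2));
  [apply/funext => v; exact: japaneseE|cts].
Qed.

Lemma enorm_continuous : continuous (@enorm R).
Proof. by rewrite /enorm; cts. Qed.

Lemma enorm_ge0 v : 0 <= enorm v. Proof. exact: sqrtr_ge0. Qed.

Lemma enorm_sqr v : enorm v ^+ 2 = v.1 ^+ 2 + v.2 ^+ 2.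
Proof. by rewrite sqr_sqrtr// addr_ge0 ?sqr_ge0. Qed.

Lemma ler_enorm1 v : `|v.1| <= enorm v.
Proof.
rewrite -(@ler_pXn2r _ 2)// ?nnegrE// ?enorm_ge0// enorm_sqr real_normK ?num_real//.
by rewrite lerDl sqr_ge0.
Qed.

Lemma ler_enorm2 v : `|v.2| <= enorm v.
Proof.
rewrite -(@ler_pXn2r _ 2)// ?nnegrE// ?enorm_ge0// enorm_sqr real_normK ?num_real//.
by rewrite lerDr sqr_ge0.
Qed.

Lemma vhat1_continuous : continuous (@vhat1 R).
Proof.
rewrite /vhat1; have cj := japanese_continuous; cts.
by rewrite gt_eqF// japanese_gt0.
Qed.

Lemma vhat2_continuous : continuous (@vhat2 R).
Proof.
rewrite /vhat2; have cj := japanese_continuous; cts.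
by rewrite gt_eqF// japanese_gt0.
Qed.

Lemma enorm_le_japanese v : enorm v <= japanese v.
Proof.
rewrite -(@ler_pXn2r _ 2)// ?nnegrE// ?enorm_ge0// ?(ltW (japanese_gt0 _))//.
by rewrite japanese_sqr enorm_sqr -addrA lerDr.
Qed.

Lemma vhat1_le1 v : `|vhat1 v| <= 1.
Proof.
rewrite normrM normfV [`|japanese v|]gtr0_norm ?japanese_gt0//.
by rewrite ler_pdivrMr ?japanese_gt0// mul1r (le_trans (ler_enorm1 v))// enorm_le_japanese.
Qed.

End kinematics.

Lemma is_derive_enorm (R : realType) (v1 v2 c d : R) : 0 < enorm (v1, v2) ->
  is_derive (0:R) (1:R) (fun s => enorm (v1 + s * c, v2 + s * d))
    ((v1 * c + v2 * d) / enorm (v1, v2)).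
Proof.
move=> v0; rewrite /enorm /=; der.
  by move: v0; rewrite /enorm /= sqrtr_gt0 !mul0r !addr0.
rewrite !mul0r !addr0 -[Num.sqrt _]/(enorm (v1, v2)).
by field; rewrite gt_eqF.
Qed.

Lemma near_right_lt (R : realType) (g : R -> R) (a b : R) :
  continuous_at a g -> g a < b -> \forall s \near a^'+, g s < b.
Proof. by move=> /cvg_at_right_filter gc gb; exact: (cvgr_lt _ gc). Qed.

Lemma near_right_gt (R : realType) (g : R -> R) (a b : R) :
  continuous_at a g -> b < g a -> \forall s \near a^'+, b < g s.
Proof. by move=> /cvg_at_right_filter gc gb; exact: (cvgr_gt _ gc). Qed.

(** * Propagation along the Vlasov field *)

Section transport.
Context (R : realType) (T : R) (f ft fx f1 f2 : R * R * (R * R) -> R)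
  (E1 E2 B : R * R -> R) (bext : R -> R).
Hypothesis T0 : 0 < T.
Hypothesis fC : C1_phase T f ft fx f1 f2.

Definition force1 (t x : R) (v : R * R) := E1 (t, x) + vhat2 v * (B (t, x) + bext x).
Definition force2 (t x : R) (v : R * R) := E2 (t, x) - vhat1 v * (B (t, x) + bext x).

Hypothesis vlasov : forall t x v, t \in `]0, T[ -> Omega x ->
  ft (t, x, v) + vhat1 v * fx (t, x, v) + force1 t x v * f1 (t, x, v)
  + force2 t x v * f2 (t, x, v) = 0.
Hypothesis f_bd : forall t x v, bdOmega x -> f (t, x, v) = 0.

Definition backward (t x : R) (v : R * R) (s : R) : R * R * (R * R) :=
  (t + s * -1, x + s * - vhat1 v,
   (v.1 + s * - force1 t x v, v.2 + s * - force2 t x v)).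

(** Since [f] vanishes at the walls, a point where [sg * f > 0] is interior, so the
    backward line stays in the strip for a short time; the hypotheses on [K] and
    [h] are what remains to be checked in each application. *)
Lemma transport_max_principle (sg : R) (t0 M : R) (K : set (R * R * (R * R)))
    (h : R * R * (R * R) -> R) :
  t0 < T -> compact K -> 0 < M -> (forall z, K z -> h z <= M) ->
  (forall t x v, K (t, x, v) -> t \in `[0, t0] /\ Omegabar x) ->
  (forall x v, K (0, x, v) -> Omega x -> 0 < sg * f (0, x, v) -> h (0, x, v) <= 0) ->
  (forall t x v, K (t, x, v) -> Omega x -> {for (t, x, v), continuous h}) ->
  (forall t x v, K (t, x, v) -> 0 < t -> Omega x -> 0 < sg * f (t, x, v) ->
     0 < h (t, x, v) ->
     (\forall s \near (0:R)^'+, s < t -> Omegabar (x + s * - vhat1 v) -> K (backward t x v s)) /\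
     exists2 d, 0 < d & is_derive (0:R) (1:R) (h \o backward t x v) d) ->
  forall z, K z -> 0 < sg * f z -> h z <= 0.
Proof.
move=> t0T cK M0 hM Kt Kinit hc hback.
have [[fc _ _ _ _] df] := fC.
have inside t x v : K (t, x, v) -> 0 < sg * f (t, x, v) -> Omega x.
  move=> /Kt[_]; rewrite /Omegabar/Omega /= !in_itv/= => /andP[x0 x1] fp.
  rewrite !lt_neqAle x0 x1 !andbT; apply/andP; split; apply/negP => /eqP xE;
    move: fp; rewrite f_bd ?mulr0 ?ltxx//.
  - by left.
  - by right.
apply: (no_pos_max cK _ M0 hM); first by cts.
  by move=> [[t x] v] Kz /(inside _ _ _ Kz); exact: hc.
move=> [[t x] v] Kz fp hp; have x01 := inside _ _ _ Kz fp.
have [t0' _] := Kt _ _ _ Kz.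
have tp : 0 < t.
  move: t0'; rewrite in_itv/= => /andP[]; rewrite le_eqVlt => /predU1P[t00|//] _.
  by move: Kz fp hp; rewrite -t00 => Kz fp; rewrite ltNge (Kinit _ _ Kz).
have [Kb [d d0 dh]] := hback _ _ _ Kz tp x01 fp hp.
exists (backward t x v), d; split => //.
- by rewrite /backward !mul0r !addr0 -surjective_pairing.
- have xb : \forall s \near (0:R)^'+, Omegabar (x + s * - vhat1 v).
    have cx : continuous_at (0:R) (fun s => x + s * - vhat1 v) by cts.
    move: (x01); rewrite /Omega /= in_itv/= => /andP[xg0 xl1].
    near=> s; rewrite /Omegabar /= in_itv/=; apply/andP; split; apply: ltW; near: s.
      by apply: near_right_gt cx _; rewrite mul0r addr0.
    by apply: near_right_lt cx _; rewrite mul0r addr0.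
  have st : \forall s \near (0:R)^'+, s < t by exact: nbhs_right_lt.
  by near=> s; apply: (near Kb s) => //; near: s.
- have tT : t \in `]0, T[.
    move: t0'; rewrite !in_itv/= tp => /andP[_ tt0] /=; exact: le_lt_trans t0T.
  have := df t x v.1 v.2 (-1) (- vhat1 v) (- force1 t x v) (- force2 t x v) tT x01.
  rewrite -surjective_pairing => /= dfb.
  rewrite (_ : _ \o _ = (fun s => sg * (f \o backward t x v) s)); last by [].
  apply: (is_derive_eq (is_deriveZ sg dfb)).
  have := vlasov v tT x01; set a := (X in X = 0) => a0.
  transitivity (- sg * a); last by rewrite a0 mulr0.
  by rewrite /a /GRing.scale /=; ring.
Unshelve. all: by end_near. Qed.

Lemma mulr_gt0_ge0 (a b : R) : 0 <= a -> 0 <= b -> 0 < a * b -> 0 < a /\ 0 < b.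
Proof. by move=> a0 b0; rewrite !lt0r a0 b0 !andbT mulf_eq0 negb_or => /andP[/andP[]]. Qed.

Lemma sgr_mul_gt0 (x : R) : x != 0 -> 0 < Num.sg x * x.
Proof. by move=> x0; rewrite -normrEsg normr_gt0. Qed.

(** Strict version, at times before [T].  The factor [lo] is positive where the
    bound fails.  The factor [hi] is a second barrier, far outside, that makes the
    domain compact although the support of [f] is not known to be bounded yet:
    along the field [|v|] changes slower than [C * t], so [lo] and [hi] both
    decrease strictly and so does their product. *)
Lemma transport_support_step (k0 C t0 x0 : R) (v0 : R * R) :
  0 <= k0 -> 0 <= C ->
  (forall t x, t \in `]0, T[ -> Omega x -> `|E1 (t, x)| + `|E2 (t, x)| < C) ->
  (forall x v, Omega x -> f (0, x, v) != 0 -> enorm v <= k0) ->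
  0 <= t0 -> t0 < T -> Omega x0 -> f (t0, x0, v0) != 0 -> enorm v0 <= k0 + C * t0.
Proof.
move=> k00 C0 HC Hinit t00 t0T x01 fn0; rewrite leNgt; apply/negP => v0k.
have fp := sgr_mul_gt0 fn0; move: fp; set sg := Num.sg _ => fp.
(* chosen so that [hi (t0, x0, v0) = 1] *)
pose L := enorm v0 + C * t0 + 1.
have L0 : 0 < L by rewrite ltr_wpDl// addr_ge0 ?enorm_ge0 ?mulr_ge0.
pose lo (z : R * R * (R * R)) : R := enorm z.2 - k0 - C * z.1.1.
pose hi (z : R * R * (R * R)) : R := L - C * z.1.1 - enorm z.2.
pose K : set (R * R * (R * R)) :=
  (`[0, t0] `*` `[0, 1] `*` (`[- L, L] `*` `[- L, L]))
    `&` ([set z | 0 <= lo z] `&` [set z | 0 <= hi z]).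
have ce := @enorm_continuous R.
have clo : continuous lo by rewrite /lo; cts.
have chi : continuous hi by rewrite /hi; cts.
have cK : compact K.
  apply: compact_closedI.
    by do !apply: compact_setX; exact: segment_compact.
  by apply: closedI; exact: closed_superlevel.
have K0 : K (t0, x0, v0).
  have hL : enorm v0 <= L by rewrite /L -addrA lerDl addr_ge0 ?mulr_ge0.
  split; [split; split|split] => /=.
  - by rewrite in_itv/= t00 lexx.
  - exact: subset_itv_oo_cc x01.
  - by rewrite in_itv/= -ler_norml (le_trans (ler_enorm1 _)).
  - by rewrite in_itv/= -ler_norml (le_trans (ler_enorm2 _)).
  - by rewrite /lo /= subr_ge0 lerBrDl ltW// addrC.
  - by rewrite /hi /L /=; lra.
pose h (z : R * R * (R * R)) := lo z * hi z.
have hp : 0 < h (t0, x0, v0).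
  by rewrite /h /lo /hi /L /=; apply: mulr_gt0; lra.
suff H : forall z, K z -> 0 < sg * f z -> h z <= 0.
  by have := H _ K0 fp; rewrite leNgt hp.
apply: (transport_max_principle t0T cK (mulr_gt0 L0 L0)).
- move=> z [[[z1 _] _] [/= lz hz]].
  have z0 : 0 <= z.1.1 by move: z1; rewrite /= in_itv/= => /andP[].
  have Cz : 0 <= C * z.1.1 by rewrite mulr_ge0.
  have en := enorm_ge0 z.2.
  by apply: ler_pM => //; move: lz hz; rewrite /lo /hi; lra.
- by move=> t x v [[[]]].
- move=> x v [_ [/= lz _]] xO fx0; have f0 : f (0, x, v) != 0.
    by apply: contraTneq fx0 => ->; rewrite mulr0 ltxx.
  have := Hinit _ _ xO f0; move: lz; rewrite /h /lo /= mulr0 subr0 subr_ge0 => k1 k2.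
  suff -> : enorm v = k0 by rewrite subrr mul0r.
  by apply: le_anti; rewrite k1 k2.
- by move=> t x v _ _; rewrite /h; cts.
move=> t x v Kz tp xO _ hz; have [[[t0' _] _] [/= lz hz']] := Kz.
have [lp hip] := mulr_gt0_ge0 lz hz' hz.
have vp : 0 < enorm v.
  have Ct : 0 <= C * t by rewrite mulr_ge0// ltW.
  by move: lp; rewrite /lo /=; lra.
have b0 : backward t x v 0 = (t, x, v).
  by rewrite /backward !mul0r !addr0 -surjective_pairing.
split.
  have cb : continuous (backward t x v) by rewrite /backward; cts.
  have clob : continuous_at (0:R) (fun s => lo (backward t x v s)) by cts.
  have chib : continuous_at (0:R) (fun s => hi (backward t x v s)) by cts.
  near=> s => st xs.
  have sp : 0 < s by near: s; exact: nbhs_right_gt.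
  have ls : 0 < lo (backward t x v s).
    by near: s; apply: near_right_gt clob _; rewrite b0.
  have hs : 0 < hi (backward t x v s).
    by near: s; apply: near_right_gt chib _; rewrite b0.
  move: t0'; rewrite /= in_itv/= => /andP[_ tt0].
  have ts : 0 <= t + s * -1 <= t0 by lra.
  have hL : enorm (backward t x v s).2 <= L.
    have : 0 <= C * (t + s * -1) by apply: mulr_ge0 => //; case/andP: ts.
    by move: hs; rewrite /hi /=; lra.
  split; [split; split|split] => /=; rewrite ?in_itv/= -?ler_norml //.
  - exact: le_trans (ler_enorm1 _) hL.
  - exact: le_trans (ler_enorm2 _) hL.
  - exact: ltW.
  - exact: ltW.
set n := (v.1 * - force1 t x v + v.2 * - force2 t x v) / enorm v.
have dE : is_derive (0:R) (1:R)
    (fun s => enorm (v.1 + s * - force1 t x v, v.2 + s * - force2 t x v)) n.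
  by have := @is_derive_enorm _ v.1 v.2 (- force1 t x v) (- force2 t x v);
    rewrite -surjective_pairing; apply.
have nC : `|n| < C.
  have tT : t \in `]0, T[.
    by move: t0'; rewrite /= !in_itv/= tp => /andP[_ tt0]; exact: le_lt_trans t0T.
  apply: le_lt_trans (HC _ _ tT xO).
  (* the magnetic force does no work *)
  have -> : n = - (v.1 * E1 (t, x) + v.2 * E2 (t, x)) / enorm v.
    congr (_ / _); rewrite /force1 /force2 /vhat1 /vhat2; ring.
  rewrite normrM normrN normfV (gtr0_norm vp) ler_pdivrMr//.
  rewrite (le_trans (ler_normD _ _))// mulrDl !normrM lerD//.
    by rewrite mulrC ler_wpM2l ?ler_enorm1.
  by rewrite mulrC ler_wpM2l ?ler_enorm2.
exists ((n + C) * hi (t, x, v) + lo (t, x, v) * (C - n)).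
  by move: nC; rewrite ltr_norml => /andP[? ?]; rewrite addr_gt0// mulr_gt0//; lra.
rewrite (_ : _ \o _ = fun s => lo (backward t x v s) * hi (backward t x v s)) //.
rewrite /lo /hi /backward /=; der.
rewrite /= !mul0r !addr0 -surjective_pairing; ring.
Unshelve. all: by end_near. Qed.

(** Strictness is removed by letting [C'] decrease to [C], and the final time is
    reached by continuity of [f], whose support at time [T] meets a point only if
    the support at slightly earlier times does. *)
Lemma support_limit (q : R -> R * R -> R) (b C : R) :
  (forall C' t x v, C < C' -> 0 <= t < T -> Omega x -> f (t, x, v) != 0 ->
     q x v <= b + C' * t) ->
  0 <= C ->
  forall t x v, t \in `[0, T] -> Omega x -> f (t, x, v) != 0 -> q x v <= b + C * t.
Proof.
move=> H C0 t x v tT xO fn0; have [[cf _ _ _ _] _] := fC.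
have [t0 tT'] : 0 <= t /\ t <= T by move: tT; rewrite in_itv/= => /andP[].
apply/ler_addgt0Pr => e e0.
have t1 : 0 < t + 1 by rewrite ltr_wpDl.
have [d0 dt] : 0 < e / (t + 1) /\ e / (t + 1) * t <= e.
  by split; [rewrite divr_gt0|rewrite mulrAC ler_pdivrMr// ler_wpM2l ?ltW// ltrDl].
have HC : C < C + e / (t + 1) by rewrite ltrDl.
suff : q x v <= b + (C + e / (t + 1)) * t by lra.
have [tlT|] := ltP t T; first by apply: H => //; rewrite t0.
move=> Tt; have {tT'}tE : t = T by apply: le_anti; rewrite tT'.
have tp : 0 < t by rewrite tE.
have cft : continuous_at (0:R) (fun s => `|f (t - s, x, v)|) by cts.
near (0:R)^'+ => s.
have sp : 0 < s by near: s; exact: nbhs_right_gt.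
have st : s < t by near: s; exact: nbhs_right_lt.
have fs : f (t - s, x, v) != 0.
  rewrite -normr_gt0; near: s; apply: near_right_gt cft _.
  by rewrite subr0 normr_gt0.
have ts : 0 <= t - s < T by rewrite -tE; lra.
apply: le_trans (H _ _ _ _ HC ts xO fs) _.
rewrite lerD2l ler_wpM2l//; first by rewrite addr_ge0// ltW.
by lra.
Unshelve. all: by end_near. Qed.

Lemma transport_momentum_bound (k0 C : R) :
  0 <= k0 -> 0 <= C ->
  (forall t x, t \in `]0, T[ -> Omega x -> `|E1 (t, x)| + `|E2 (t, x)| <= C) ->
  (forall x v, Omega x -> f (0, x, v) != 0 -> enorm v <= k0) ->
  forall t x v, t \in `[0, T] -> Omega x -> f (t, x, v) != 0 ->
    enorm v <= k0 + C * t.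
Proof.
move=> k00 C0 HC Hinit; apply: (support_limit (q := fun=> @enorm R)) => //.
move=> C' t x v CC' /andP[t0 tT] xO; apply: transport_support_step => //.
  exact: le_trans (ltW CC').
by move=> s y sT yO; apply: le_lt_trans CC'; exact: HC.
Qed.

Hypothesis f0_ge0 : forall x v, Omega x -> 0 <= f (0, x, v).
Context (L : R).
Hypothesis f_supp : forall t x v, L < enorm v -> f (t, x, v) = 0.

(** Once the support is bounded, one compact set serves all weights [h]. *)
Let cylinder (t0 : R) : set (R * R * (R * R)) :=
  `[0, t0] `*` `[0, 1] `*` (`[- (L + 1), L + 1] `*` `[- (L + 1), L + 1]).

Let cylinder_compact t0 : compact (cylinder t0).
Proof. by do !apply: compact_setX; exact: segment_compact. Qed.

Let cylinder_in t0 t x v : t \in `[0, t0] -> Omegabar x -> f (t, x, v) != 0 ->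
  cylinder t0 (t, x, v).
Proof.
move=> tt0 xO fn0; have vL : enorm v <= L + 1.
  apply: (@le_trans _ _ L); last by rewrite lerDl.
  by rewrite leNgt; apply: contra_neqN fn0; exact: f_supp.
by split; [split|split] => //=; rewrite in_itv/= -ler_norml;
  [apply: le_trans vL; exact: ler_enorm1|apply: le_trans vL; exact: ler_enorm2].
Qed.

Let cylinder_backward t0 t x v : cylinder t0 (t, x, v) -> f (t, x, v) != 0 ->
  \forall s \near (0:R)^'+, s < t -> Omegabar (x + s * - vhat1 v) ->
    cylinder t0 (backward t x v s).
Proof.
move=> [[tt _] _] fn0; have vL : enorm v <= L.
  by rewrite leNgt; apply: contra_neqN fn0; exact: f_supp.
have ce := @enorm_continuous R.
have cb : continuous_at (0:R) (fun s => enorm (backward t x v s).2).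
  by rewrite /backward; cts.
near=> s => st xs.
have sp : 0 < s by near: s; exact: nbhs_right_gt.
have es : enorm (backward t x v s).2 <= L + 1.
  apply: ltW; near: s; apply: near_right_lt cb _.
  by rewrite /backward /= !mul0r !addr0 -surjective_pairing (le_lt_trans vL)// ltrDl.
move: tt; rewrite /= in_itv/= => /andP[t0' tt0].
by split; [split|split] => //=; rewrite in_itv/= -?ler_norml;
  [lra|exact: le_trans (ler_enorm1 _) es|exact: le_trans (ler_enorm2 _) es].
Unshelve. all: by end_near. Qed.

(** The weight is [1 + t - s] as a function of the time [s]: it is positive up to
    [t] and has slope [-1]. *)
Lemma transport_ge0 t x v : t \in `[0, T[ -> Omegabar x -> 0 <= f (t, x, v).
Proof.
move=> tT xO; rewrite leNgt; apply/negP => fneg.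
have fn0 : f (t, x, v) != 0 by rewrite lt_eqF.
move: tT; rewrite in_itv/= => /andP[t0 tT].
have M0 : 0 < 1 + t by rewrite ltr_wpDr.
suff : forall z, cylinder t z -> 0 < -1 * f z -> 1 + t - z.1.1 <= 0.
  move=> /(_ (t, x, v)); rewrite /= addrK ler10 mulN1r oppr_gt0 => H.
  by suff : false by []; apply: H => //; apply: cylinder_in => //; rewrite in_itv/= t0 lexx.
have nz z : 0 < -1 * f z -> f z != 0.
  by apply: contraTneq => ->; rewrite mulr0 ltxx.
apply: (transport_max_principle tT (@cylinder_compact t) M0).
- by move=> [[s y] w] [[/= sT _] _]; move: sT; rewrite in_itv/= => /andP[s0 _]; lra.
- by move=> s y w [[]].
- by move=> y w _ yO; rewrite mulN1r oppr_gt0 ltNge f0_ge0.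
- by move=> s y w _ _; cts.
move=> s y w Ks s0 yO /nz fs _; split; first exact: cylinder_backward.
exists 1 => //; rewrite (_ : _ \o _ = fun r => 1 + t - (s + r * -1))//; der.
by rewrite /=; ring.
Qed.

(** Along the field [v2 + psi x] has derivative
    [E2 - vhat1 * (B + bext) + vhat1 * bext = E2 - vhat1 * B]. *)
Lemma transport_canonical_momentum (psi : R -> R) (a C sg : R) :
  (forall x, Omega x -> is_derive x (1:R) psi (bext x)) ->
  sg ^+ 2 = 1 -> 0 <= C ->
  (forall t x, t \in `]0, T[ -> Omega x -> `|E2 (t, x)| + `|B (t, x)| <= C) ->
  (forall x v, Omega x -> f (0, x, v) != 0 -> sg * (v.2 + psi x) <= a) ->
  forall t x v, t \in `[0, T] -> Omega x -> f (t, x, v) != 0 ->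
    sg * (v.2 + psi x) <= a + C * t.
Proof.
move=> dpsi sg1 C0 HC Hinit.
apply: (support_limit (q := fun x v => sg * (v.2 + psi x))) => //.
move=> C' t0 x0 v0 CC' /andP[t00 t0T] xO0 fn0.
pose q (z : R * R * (R * R)) := sg * (z.2.2 + psi z.1.2) - a - C' * z.1.1.
(* [psi] may be unbounded near the walls: [h] has the sign of [q] but is
   bounded above *)
pose h z := 1 - expR (- q z).
have h_gt0 z : (0 < h z) = (0 < q z).
  by rewrite /h subr_gt0 -[X in _ < X]expR0 ltr_expR oppr_lt0.
have nz sg' z : 0 < sg' * f z -> f z != 0.
  by apply: contraTneq => ->; rewrite mulr0 ltxx.
suff H : forall z, cylinder t0 z -> 0 < Num.sg (f (t0, x0, v0)) * f z -> h z <= 0.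
  have := H (t0, x0, v0); rewrite leNgt h_gt0 -leNgt /q /= => Hq.
  rewrite -lerBlDl -subr_le0; apply: Hq (sgr_mul_gt0 fn0).
  by apply: cylinder_in => //; [rewrite in_itv/= t00 lexx|exact: subset_itv_oo_cc xO0].
apply: (transport_max_principle t0T (@cylinder_compact t0) ltr01).
- by move=> z _; rewrite /h gerBl expR_ge0.
- by move=> s y w [[]].
- move=> y w _ yO /nz fy; rewrite leNgt h_gt0 -leNgt /q /= mulr0 subr0 subr_le0.
  exact: Hinit.
- move=> s y w _ yO; have cpsi : continuous_at y psi.
    exact: is_derive_continuous (dpsi _ yO).
  have cexp := @continuous_expR R.
  rewrite /h /q; cts.
  by apply: (@cts_comp _ _ _ psi) => //=; cts.
move=> s y w Ks s0 yO /nz fs _; split; first exact: cylinder_backward.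
have sT : s \in `]0, T[.
  case: Ks => [[]] /=; rewrite !in_itv/= s0 => /andP[_ st0] _ _.
  exact: le_lt_trans t0T.
set d := sg * (vhat1 w * B (s, y) - E2 (s, y)) + C'.
exists (expR (- q (s, y, w)) * d).
  rewrite mulr_gt0 ?expR_gt0// /d -ltrBlDr sub0r.
  have sgn : `|sg| = 1 by apply/eqP; rewrite -(@eqrXn2 _ 2)// real_normK ?num_real// sg1 expr1n.
  have : `|sg * (vhat1 w * B (s, y) - E2 (s, y))| < C'.
    apply: le_lt_trans CC'; apply: le_trans (HC _ _ sT yO).
    rewrite normrM sgn mul1r (le_trans (ler_normB _ _))// addrC lerD2l normrM.
    by rewrite ler_piMl ?vhat1_le1.
  by rewrite ltr_norml => /andP[].
have dpsi' : is_derive (0:R) (1:R) (fun r => psi (y + r * - vhat1 w)) (bext y * - vhat1 w).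
  have dy : is_derive (0:R) (1:R) (fun r => y + r * - vhat1 w) (- vhat1 w).
    by der; rewrite /=; ring.
  have dpy : is_derive (y + 0 * - vhat1 w) (1:R) psi (bext y).
    by rewrite mul0r addr0; exact: dpsi.
  exact: (@der_comp _ psi (fun r => y + r * - vhat1 w) _ _ _ dpy dy).
have dq : is_derive (0:R) (1:R) (fun r => - q (backward s y w r)) (- d).
  rewrite /q /backward /=; der; rewrite /d /force2 /=; ring.
have dexp : is_derive (- q (backward s y w 0)) (1:R) expR (expR (- q (backward s y w 0))).
  exact: is_derive_expR.
have de := @der_comp _ expR (fun r => - q (backward s y w r)) _ _ _ dexp dq.
have b0 : backward s y w 0 = (s, y, w).
  by rewrite /backward !mul0r !addr0 -surjective_pairing.
rewrite (_ : _ \o _ = fun r => 1 - expR (- q (backward s y w r)))//; der.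
by rewrite /= b0; ring.
Qed.
End transport.

(** * Measurability of continuous functions of several variables *)

Section measurable_base.

(** Second countability compatible with a sigma-algebra.  It passes to products,
    whose open sets are thereby measurable for the product sigma-algebra. *)
Definition measurable_base (T : topologicalType) (m : set (set T)) : Prop :=
  exists b : nat -> set T, (forall n, m (b n)) /\
    forall x U, nbhs x U -> exists2 n, b n x & b n `<=` U.

Lemma measurable_base_prod (T1 T2 : topologicalType) (m1 : set (set T1))
    (m2 : set (set T2)) (m : set (set (T1 * T2))) :
  (forall A B, m1 A -> m2 B -> m (A `*` B)) ->
  measurable_base m1 -> measurable_base m2 -> measurable_base m.
Proof.
move=> mX [b1 [mb1 Hb1]] [b2 [mb2 Hb2]].
exists (fun n => let p := odflt (0, 0)%N (unpickle n) in b1 p.1 `*` b2 p.2).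
split=> [n|[x y] U]; first exact: mX.
move=> [[A B] /= [/Hb1[n1 n1x n1A] /Hb2[n2 n2y n2B]] ABU].
exists (pickle (n1, n2)); rewrite pickleK //= => -[z w] [/= zn wn].
by apply: ABU; split; [exact: n1A|exact: n2B].
Qed.

Lemma measurable_base_R (R : realType) :
  measurable_base (@measurable _ (measurableTypeR R) : set (set R)).
Proof.
exists (fun n => let p := odflt (0, 0) (unpickle n) : rat * rat in
  `]ratr p.1, ratr p.2[%classic); split=> [n|x U]; first exact: measurable_itv.
move=> /nbhs_ballP[e /= e0 xU].
have [q qx] : exists q, ratr q \in `]x - e, x[ by apply: rat_in_itvoo; rewrite ltrBlDr ltrDl.
have [r rx] : exists q, ratr q \in `]x, x + e[ by apply: rat_in_itvoo; rewrite ltrDl.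
move: qx rx; rewrite !in_itv/= => /andP[eq qx] /andP[xr re].
exists (pickle (q, r)); rewrite pickleK /= ?in_itv/= ?qx//.
move=> y /=; rewrite in_itv/= => /andP[qy yr]; apply: xU.
by rewrite /ball /= ltr_distlC (lt_trans eq qy) (lt_trans yr re).
Qed.

Lemma open_measurable_base (T : topologicalType) (m : set (set T)) (U : set T) :
  m set0 -> (forall F : nat -> set T, (forall n, m (F n)) -> m (\bigcup_n F n)) ->
  measurable_base m -> open U -> m U.
Proof.
move=> m0 mU [b [mb Hb]] oU.
have -> : U = \bigcup_n (if `[< b n `<=` U >] then b n else set0).
  apply/seteqP; split=> [x Ux|x [n _]]; last by case: asboolP => // + bx; exact.
  have [n bx bU] := Hb _ _ (open_nbhs_nbhs (conj oU Ux)).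
  by exists n => //; rewrite asboolT.
by apply: mU => n; case: ifPn.
Qed.
End measurable_base.

Section continuous_measurable.
Context (R : realType).

Lemma measurable_base_R2 :
  measurable_base (@measurable _ (R * R)%type : set (set (R * R))).
Proof.
apply: (measurable_base_prod _ (@measurable_base_R R) (@measurable_base_R R)).
by move=> A B mA mB; exact: measurableX.
Qed.

Lemma measurable_base_R3 :
  measurable_base (@measurable _ (R * (R * R))%type : set (set (R * (R * R)))).
Proof.
apply: (measurable_base_prod _ (@measurable_base_R R) measurable_base_R2).
by move=> A B mA mB; exact: measurableX.
Qed.

Lemma continuous_measurable_R2 (g : R * R -> R) : continuous g -> measurable_fun setT g.
Proof.
move=> /continuousP cg; apply: (measurability _ (RGenOpens.measurableE R)).
move=> _ [_ [a [b ->] <-]]; rewrite setTI.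
apply: (open_measurable_base _ _ measurable_base_R2) => //.
  by move=> F mF; exact: bigcupT_measurable.
exact/cg/interval_open.
Qed.

Lemma continuous_measurable_R3 (g : R * (R * R) -> R) : continuous g -> measurable_fun setT g.
Proof.
move=> /continuousP cg; apply: (measurability _ (RGenOpens.measurableE R)).
move=> _ [_ [a [b ->] <-]]; rewrite setTI.
apply: (open_measurable_base _ _ measurable_base_R3) => //.
  by move=> F mF; exact: bigcupT_measurable.
exact/cg/interval_open.
Qed.
End continuous_measurable.

(** * Integrals of continuous functions depending on a parameter *)

Lemma compact_near_uniform (R : realType) (Z Y : topologicalType) (K : set Y)
    (g : Z * Y -> R) (z0 : Z) (e : R) :
  compact K -> continuous g -> 0 < e ->
  \forall z \near z0, forall y, K y -> `|g (z, y) - g (z0, y)| <= e.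
Proof.
move=> /compact_near_coveringP cK cg e0.
apply: (cK _ _ (fun z y => `|g (z, y) - g (z0, y)| <= e)) => y Ky.
pose k (p : Y * Z) : R := `|g (p.2, p.1) - g (z0, p.1)|.
have ck : continuous_at (y, z0) k by rewrite /k; cts.
have k0 : k (y, z0) < e by rewrite /k /= subrr normr0.
have : \forall p \near (y, z0), k p < e by exact: (cvgr_lt _ ck).
by apply: filterS => -[y' z'] /= /ltW.
Qed.

Section finite_measure_integral.
Context (R : realType) d (Y : measurableType d) (mu : {measure set Y -> \bar R})
  (A : set Y).
Hypotheses (mA : measurable A) (finA : (mu A < +oo)%E).

Lemma bounded_integrable (g : Y -> R) (M : R) :
  measurable_fun A g -> (forall y, A y -> `|g y| <= M) ->
  mu.-integrable A (EFin \o g).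
Proof.
move=> mg gM; apply: measurable_bounded_integrable => //.
exists M; split; first exact: num_real.
by move=> m Mm y Ay /=; exact: le_trans (gM _ Ay) (ltW Mm).
Qed.

Lemma ler_norm_Rintegral (g : Y -> R) (M : R) :
  mu.-integrable A (EFin \o g) -> (forall y, A y -> `|g y| <= M) ->
  `|\int[mu]_(y in A) g y| <= M * fine (mu A).
Proof.
move=> ig gM; apply: le_trans (le_normr_Rintegral _ _) _ => //.
rewrite -(Rintegral_cst _ mA); apply: le_Rintegral => //.
- exact: integrable_abse ig.
- apply: (@bounded_integrable (cst M) `|M|); first exact: measurable_cst.
  by [].
Qed.

Lemma cvg_Rintegral_uniform (T : Type) (F : set_system T) (FF : Filter F)
    (g : T -> Y -> R) (g0 : Y -> R) :
  (forall t, mu.-integrable A (EFin \o g t)) -> mu.-integrable A (EFin \o g0) ->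
  (forall e, 0 < e -> \forall t \near F, forall y, A y -> `|g t y - g0 y| <= e) ->
  \int[mu]_(y in A) g t y @[t --> F] --> \int[mu]_(y in A) g0 y.
Proof.
move=> ig ig0 H; apply/cvgrPdist_le => e e0.
have m0 : 0 < fine (mu A) + 1 by rewrite ltr_wpDl// fine_ge0.
have := H (e / (fine (mu A) + 1)) (divr_gt0 e0 m0).
apply: filterS => t Ht; rewrite distrC -RintegralB//.
apply: le_trans (ler_norm_Rintegral _ Ht) _.
  rewrite (_ : _ \o _ = (EFin \o g t) \- (EFin \o g0))%E; last first.
    by apply/funext => y; rewrite /= EFinB.
  exact: integrableB.
by rewrite mulrAC ler_pdivrMr// ler_wpM2l ?ltW// ltrDl.
Qed.

Lemma is_derive_Rintegral (u v a M : R) (f df : R -> Y -> R) :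
  a \in `]u, v[ ->
  (forall x, mu.-integrable A (EFin \o f x)) ->
  (forall x y, x \in `]u, v[ -> A y -> is_derive x (1:R) (f ^~ y) (df x y)) ->
  (forall x y, x \in `]u, v[ -> A y -> `|df x y| <= M) ->
  is_derive a (1:R) (fun x => \int[mu]_(y in A) f x y) (\int[mu]_(y in A) df a y).
Proof.
move=> auv intf Df dfM.
have Mi : mu.-integrable A (EFin \o cst `|M|).
  by apply: (@bounded_integrable _ `|M|); [exact: measurable_cst|move=> y _; rewrite normr_id].
have dE x y : x \in `]u, v[ -> A y -> partial1of2 f x y = df x y.
  by move=> xuv Ay; rewrite partial1of2E; have [] := Df _ _ xuv Ay.
have d1 x y : `]u, v[%classic x -> A y -> derivable (f ^~ y) x 1.
  by move=> xuv Ay; have [] := Df x y xuv Ay.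
have d2 x y : `]u, v[%classic x -> A y -> `|partial1of2 f x y| <= cst `|M| y.
  by move=> xuv Ay; rewrite dE// (le_trans (dfM _ _ xuv Ay))// ler_norm.
apply: DeriveDef.
  exact: (derivable_under_integral mA auv (fun x _ => intf x) d1 (fun=> normr_ge0 M) Mi d2).
rewrite -derive1E.
rewrite (differentiation_under_integral mA auv (fun x _ => intf x) d1 (fun=> normr_ge0 M) Mi d2).
by apply: eq_Rintegral => y /set_mem Ay; rewrite dE.
Qed.

End finite_measure_integral.

Lemma compact_bounded (R : realType) (Y : topologicalType) (K : set Y) (g : Y -> R) :
  compact K -> continuous g -> exists M, forall y, K y -> `|g y| <= M.
Proof.
move=> cK cg; have [[y0 Ky0]|/set0P/negP/negPn/eqP K0] := pselect (K !=set0); last first.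
  by exists 0 => y; rewrite K0.
have cn : {within K, continuous (fun y => `|g y|)}.
  by apply: continuous_subspaceT; cts.
have [c _ Hc] := compact_EVT_max (ex_intro _ y0 Ky0) cK cn.
by exists `|g c| => y Ky; apply: Hc; exact: mem_set.
Qed.

(** The measurable structure is carried by [Y] and the topological one by [X]; in
    the applications [i] is the identity.  The domain [A] may be smaller than the
    compact set [K], so that a derivative is needed only inside an open
    interval. *)
Section compact_domain.
Context (R : realType) d (Y : measurableType d) (mu : {measure set Y -> \bar R})
  (A : set Y) (X : topologicalType) (i : Y -> X) (K : set X).
Hypotheses (mA : measurable A) (finA : (mu A < +oo)%E) (cK : compact K)
  (AK : forall y, A y -> K (i y))
  (mi : forall g : X -> R, continuous g -> measurable_fun A (g \o i)).

Lemma compact_integrable (g : X -> R) : continuous g ->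
  mu.-integrable A (EFin \o (g \o i)).
Proof.
move=> cg; have [M gM] := compact_bounded cK cg.
by apply: (@bounded_integrable _ _ _ _ _ mA finA _ M); [exact: mi|move=> y /AK/gM].
Qed.

Lemma compact_param_continuous (Z : topologicalType) (g : Z * X -> R) :
  continuous g -> continuous (fun z => \int[mu]_(y in A) g (z, i y)).
Proof.
move=> cg z0; have ig z : mu.-integrable A (EFin \o (fun y => g (z, i y))).
  by apply: (@compact_integrable (fun y => g (z, y))); cts.
apply: (@cvg_Rintegral_uniform _ _ _ _ _ mA finA _ (nbhs z0) _
  (fun z y => g (z, i y)) (fun y => g (z0, i y))) => // e e0.
have := compact_near_uniform z0 cK cg e0.
by apply: filterS => z Hz y /AK; exact: Hz.
Qed.

Lemma compact_param_derive (u v a : R) (F dF : R * X -> R) :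
  continuous F -> continuous dF -> a \in `]u, v[ ->
  (forall x y, x \in `]u, v[ -> A y ->
     is_derive x (1:R) (fun x => F (x, i y)) (dF (x, i y))) ->
  is_derive a (1:R) (fun x => \int[mu]_(y in A) F (x, i y))
    (\int[mu]_(y in A) dF (a, i y)).
Proof.
move=> cF cdF auv D.
have [M dFM] := compact_bounded (compact_setX (@segment_compact _ u v) cK) cdF.
apply: (@is_derive_Rintegral _ _ _ _ _ mA finA u v a M
  (fun x y => F (x, i y)) (fun x y => dF (x, i y))) => //.
- by move=> x; apply: (@compact_integrable (fun y => F (x, y))); cts.
- by move=> x y xuv /AK Ky; apply: dFM; split => //=; exact: subset_itv_oo_cc xuv.
Qed.

End compact_domain.

Section box_and_segment.
Context (R : realType).
Local Notation mu := (@lebesgue_measure R).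

Definition box (L : R) : set (R * R) := `[- L, L] `*` `[- L, L].

Lemma box_measurable L : measurable (box L).
Proof. by apply: measurableX; exact: measurable_itv. Qed.

Lemma box_compact L : compact (box L).
Proof. by apply: compact_setX; exact: segment_compact. Qed.

Lemma not_box_enorm_ge L (v : R * R) : ~ box L v -> L <= enorm v.
Proof.
move=> vL; rewrite leNgt; apply/negP => vl; apply: vL.
by split => /=; rewrite in_itv/= -ler_norml ltW// (le_lt_trans _ vl)// (ler_enorm1, ler_enorm2).
Qed.

Lemma box_finite L : (lebesgue2 (box L) < +oo)%E.
Proof.
rewrite /lebesgue2 product_measure1E; [|exact: measurable_itv..].
by rewrite lte_mul_pinfty// ?ge0_fin_numE//= lebesgue_measure_itv; case: ifP => // _; rewrite ltry.
Qed.

Lemma segment_finite (a b : R) : (mu `[a, b] < +oo)%E.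
Proof. by rewrite /= lebesgue_measure_itv; case: ifP => // _; rewrite ltry. Qed.

Let mbox L (g : R * R -> R) : continuous g -> measurable_fun (box L) (g \o id).
Proof. by move=> cg; apply: measurable_funTS; exact: continuous_measurable_R2. Qed.

Let mseg (a b : R) (g : R -> R) : continuous g -> measurable_fun `[a, b] (g \o id).
Proof. by move=> cg; apply: measurable_funTS; exact: continuous_measurable_fun. Qed.

Lemma box_integrable L (g : R * R -> R) : continuous g ->
  lebesgue2.-integrable (box L) (EFin \o g).
Proof.
exact: (@compact_integrable R _ _ lebesgue2 (box L) _ id (box L)
  (box_measurable L) (box_finite L) (@box_compact L) (fun _ H => H) (@mbox L)).
Qed.

Lemma segment_integrable (a b : R) (g : R -> R) : continuous g ->
  mu.-integrable `[a, b] (EFin \o g).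
Proof.
exact: (@compact_integrable R _ _ mu `[a, b]%classic _ id `[a, b]%classic
  (measurable_itv _) (segment_finite a b) (@segment_compact R a b) (fun _ H => H) (@mseg a b)).
Qed.

Lemma box_param_continuous L (Z : topologicalType) (g : Z * (R * R) -> R) :
  continuous g -> continuous (fun z => \int[lebesgue2]_(v in box L) g (z, v)).
Proof.
exact: (@compact_param_continuous R _ _ lebesgue2 (box L) _ id (box L)
  (box_measurable L) (box_finite L) (@box_compact L) (fun _ H => H) (@mbox L)).
Qed.

Lemma segment_param_continuous (a b : R) (Z : topologicalType) (g : Z * R -> R) :
  continuous g -> continuous (fun z => \int[mu]_(y in `[a, b]) g (z, y)).
Proof.
exact: (@compact_param_continuous R _ _ mu `[a, b]%classic _ id `[a, b]%classic
  (measurable_itv _) (segment_finite a b) (@segment_compact R a b) (fun _ H => H) (@mseg a b)).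
Qed.

Lemma box_param_derive L (u v a : R) (F dF : R * (R * R) -> R) :
  continuous F -> continuous dF -> a \in `]u, v[ ->
  (forall x y, x \in `]u, v[ -> box L y ->
     is_derive x (1:R) (fun x => F (x, y)) (dF (x, y))) ->
  is_derive a (1:R) (fun x => \int[lebesgue2]_(w in box L) F (x, w))
    (\int[lebesgue2]_(w in box L) dF (a, w)).
Proof.
exact: (@compact_param_derive R _ _ lebesgue2 (box L) _ id (box L)
  (box_measurable L) (box_finite L) (@box_compact L) (fun _ H => H) (@mbox L)).
Qed.

Lemma segment_integral_oo (a b : R) (g : R -> R) : continuous g ->
  \int[mu]_(x in `[a, b]) g x = \int[mu]_(x in `]a, b[) g x.
Proof.
move=> cg; rewrite -[LHS]Rintegral_itv_obnd_cbnd; last first.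
  by apply: integrableS (segment_integrable a b cg) => //; exact: subset_itv_oc_cc.
rewrite -Rintegral_itv_bndo_bndc//.
by apply: integrableS (segment_integrable a b cg) => //; exact: subset_itv_oo_cc.
Qed.

Lemma open_segment_finite (a b : R) : (mu `]a, b[ < +oo)%E.
Proof. by rewrite /= lebesgue_measure_itv; case: ifP => // _; rewrite ltry. Qed.

Lemma segment_param_derive (b1 b2 u v a : R) (F dF : R * R -> R) :
  continuous F -> continuous dF -> a \in `]u, v[ ->
  (forall x y, x \in `]u, v[ -> y \in `]b1, b2[ ->
     is_derive x (1:R) (fun x => F (x, y)) (dF (x, y))) ->
  is_derive a (1:R) (fun x => \int[mu]_(y in `[b1, b2]) F (x, y))
    (\int[mu]_(y in `[b1, b2]) dF (a, y)).
Proof.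
move=> cF cdF auv D; have cFx (G : R * R -> R) x : continuous G -> continuous (fun y => G (x, y)).
  by move=> cG; cts.
rewrite (segment_integral_oo _ _ (cFx _ _ cdF)).
rewrite (_ : (fun x => _) = (fun x => \int[mu]_(y in `]b1, b2[) F (x, y))); last first.
  by apply/funext => x; rewrite (segment_integral_oo _ _ (cFx _ _ cF)).
have mo (g : R -> R) : continuous g -> measurable_fun `]b1, b2[ (g \o id).
  by move=> cg; apply: measurable_funTS; exact: continuous_measurable_fun.
have AK (y : R) : `]b1, b2[%classic y -> `[b1, b2]%classic y by exact: subset_itv_oo_cc.
exact: (@compact_param_derive R _ _ mu `]b1, b2[%classic _ id `[b1, b2]%classic
  (measurable_itv _) (open_segment_finite b1 b2) (@segment_compact R b1 b2) AK mo
  u v a F dF cF cdF auv D).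
Qed.

Lemma segment_FTC2 (a b : R) (F f : R -> R) : a < b ->
  continuous F -> continuous f ->
  (forall x, x \in `]a, b[ -> is_derive x (1:R) F (f x)) ->
  (\int[mu]_(x in `[a, b]) (f x)%:E = (F b - F a)%:E)%E.
Proof.
move=> ab cF cf D; rewrite EFinB.
apply: (continuous_FTC2 ab).
- exact: continuous_subspaceT.
- split.
  + by move=> x /D[].
  + by apply: cvg_at_right_filter; exact: cF.
  + by apply: cvg_at_left_filter; exact: cF.
- by move=> x xab; rewrite derive1E; have [] := D x xab.
Qed.

End box_and_segment.

(** * Divergence theorem on a square *)

Section box_fubini.
Context (R : realType) (L : R).
Local Notation mu := (@lebesgue_measure R).
Implicit Types h : R * R -> R.

Let patch_integrable h : continuous h ->
  lebesgue2.-integrable setT ((EFin \o h) \_ (box L)).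
Proof.
move=> ch.
exact: ((@integrable_mkcond _ _ R lebesgue2 (box L) (EFin \o h) (box_measurable L)).1
  (box_integrable L ch)).
Qed.

Lemma box_integral_eq0_1 h : continuous h ->
  (forall y, (\int[mu]_(x in `[(- L)%R, L]) (h (x, y))%:E = 0)%E) ->
  \int[lebesgue2]_(v in box L) h v = 0.
Proof.
move=> ch H; rewrite /Rintegral integral_mkcond.
rewrite -(integral21_prod_meas1 (patch_integrable ch)) integral0_eq//= => y _.
rewrite /fubini_G; have [yL|yL] := boolP (y \in `[- L, L]%classic).
  rewrite -(H y) [RHS]integral_mkcond; apply: eq_integral => x _.
  by rewrite /patch /box in_setX /= yL andbT.
apply: integral0_eq => x _.
by rewrite /patch /box in_setX /= (negbTE yL) andbF.
Qed.

Lemma box_integral_eq0_2 h : continuous h ->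
  (forall x, (\int[mu]_(y in `[(- L)%R, L]) (h (x, y))%:E = 0)%E) ->
  \int[lebesgue2]_(v in box L) h v = 0.
Proof.
move=> ch H; rewrite /Rintegral integral_mkcond.
rewrite -(integral12_prod_meas1 (patch_integrable ch)) integral0_eq//= => x _.
rewrite /fubini_F; have [xL|xL] := boolP (x \in `[- L, L]%classic).
  rewrite -(H x) [RHS]integral_mkcond; apply: eq_integral => y _.
  by rewrite /patch /box in_setX /= xL.
apply: integral0_eq => y _.
by rewrite /patch /box in_setX /= (negbTE xL).
Qed.

Lemma box_divergence_1 (A dA : R * R -> R) : 0 < L ->
  continuous A -> continuous dA ->
  (forall x y, is_derive x (1:R) (fun x => A (x, y)) (dA (x, y))) ->
  (forall y, A (L, y) = 0) -> (forall y, A (- L, y) = 0) ->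
  \int[lebesgue2]_(v in box L) dA v = 0.
Proof.
move=> L0 cA cdA D A1 A2; apply: box_integral_eq0_1 => // y.
rewrite (@segment_FTC2 _ _ _ (fun x => A (x, y)))//; [|lra|cts|cts].
by rewrite A1 A2 subrr.
Qed.

Lemma box_divergence_2 (A dA : R * R -> R) : 0 < L ->
  continuous A -> continuous dA ->
  (forall x y, is_derive y (1:R) (fun y => A (x, y)) (dA (x, y))) ->
  (forall x, A (x, L) = 0) -> (forall x, A (x, - L) = 0) ->
  \int[lebesgue2]_(v in box L) dA v = 0.
Proof.
move=> L0 cA cdA D A1 A2; apply: box_integral_eq0_2 => // x.
rewrite (@segment_FTC2 _ _ _ (fun y => A (x, y)))//; [|lra|cts|cts].
by rewrite A1 A2 subrr.
Qed.

End box_fubini.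

(** * Norms of continuous functions *)

Section norms.
Context (R : realType).
Local Notation mu := (@lebesgue_measure R).

(** An essential supremum dominates the value at a point of continuity, because a
    ball has positive measure. *)
Lemma Linfty_ge (D : set R) (g : R -> R) (x M : R) :
  (forall y, D y -> `|g y| <= M) ->
  nbhs x D -> {for x, continuous g} -> `|g x| <= Linfty D g.
Proof.
move=> gM Dx cg; rewrite /Linfty unlock.
have muT : (0 < mu [set: R])%E.
  apply: (@lt_le_trans _ _ (mu (ball (0:R) 1))).
    by rewrite lebesgue_measure_ball// lte_fin.
  by apply: le_measure => //; rewrite inE//; exact: measurable_ball.
rewrite muT; set F := abse \o _.
have M0 : 0 <= M by apply: le_trans (gM x (nbhs_singleton Dx)).
have F0 y : (0 <= F y)%E by exact: abse_ge0.
have s0 : (0 <= ess_sup mu F)%E by apply: ess_sup_gee => //; exact: nearW.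
have sM : (ess_sup mu F <= M%:E)%E.
  apply/ess_supP/nearW => y; rewrite /F /= lee_fin /patch; case: ifPn => [/set_mem/gM//|_].
  by rewrite normr0.
have sfin : ess_sup mu F \is a fin_num.
  by rewrite ge0_fin_numE// (le_lt_trans sM)// ltry.
rewrite leNgt; apply/negP => sg.
have [N [mN N0 HN]] := @ess_sup_ge _ _ _ mu F.
have cn : continuous_at x (fun y => `|g y|) by apply: cts_norm.
have : \forall y \near x, D y /\ fine (ess_sup mu F) < `|g y|.
  by apply: filterI => //; exact: (cvgr_gt _ cn).
move=> /nbhs_ballP[e /= e0 He].
have BN : ball x e `<=` N.
  move=> y /He[Dy gy]; apply: HN => /=; apply/negP; rewrite -ltNge.
  by rewrite -(fineK sfin) /F /= lte_fin /patch mem_set.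
have : (mu (ball x e) <= mu N)%E.
  by apply: le_measure => //; rewrite inE//; exact: measurable_ball.
by rewrite N0 (lebesgue_measure_ball _ (ltW e0)) leNgt lte_fin mulrn_wgt0.
Qed.

(** The norm is an iterated integral of a function without absolute value, over a
    compact set. *)
Lemma L1normE (L : R) (f0 G : R * (R * R) -> R) :
  continuous G -> (forall z, phase z -> f0 z = G z) -> (forall z, phase z -> 0 <= f0 z) ->
  (forall x v, ~ box L v -> G (x, v) = 0) ->
  L1norm f0 = \int[mu]_(x in `[0, 1]) \int[lebesgue2]_(v in box L) G (x, v).
Proof.
move=> cG fG f0_ge0 GL.
rewrite /L1norm Lnorm1.
have mf : measurable_fun setT (f0 \_ phase).
  have -> : f0 \_ phase = G \_ phase.
    by apply/funext => z; rewrite /patch; case: ifPn => // /set_mem; exact: fG.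
  apply/(measurable_restrictT _ _).1; first by apply: measurableX => //; exact: measurable_itv.
  by apply: measurable_funTS; exact: continuous_measurable_R3.
have cI : continuous (fun x => \int[lebesgue2]_(v in box L) G (x, v)).
  exact: box_param_continuous.
set I := fun x => _ in cI.
rewrite [RHS]segment_integral_oo//.
rewrite [RHS]Rintegral_mkcond /Rintegral; congr fine.
rewrite fubini_tonelli1//; last first.
  by do 2 apply: measurableT_comp => //.
apply: eq_integral => x _; rewrite /fubini_F [in RHS]/patch.
case: ifPn => [/set_mem x01|x01].
  have -> : (I x)%:E = (\int[lebesgue2]_(v in box L) (G (x, v))%:E)%E.
    rewrite fineK// integrable_fin_num//; first exact: box_measurable.
    by apply: (@box_integrable _ _ (fun v => G (x, v))); cts.
  rewrite [RHS]integral_mkcond; apply: eq_integral => v _.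
  rewrite /= {1}/patch mem_set// [in RHS]/patch fG//.
  rewrite ger0_norm -?fG ?f0_ge0//; case: ifPn => // /negP vL.
  by rewrite fG// GL// => bv; apply: vL; exact: mem_set.
apply: integral0_eq => v _ /=; rewrite /patch; case: ifPn => [/set_mem[/= x01' _]|_].
  by move: x01; rewrite (mem_set x01').
by rewrite normr0.
Qed.

End norms.

(** * Chain rule from two partial derivatives *)

Lemma is_deriveP (R : realType) (g : R -> R) (x d : R) :
  is_derive x (1:R) g d <-> h^-1 * (g (h + x) - g x) @[h --> (0:R)^'] --> d.
Proof.
have E : (fun h : R => h^-1 *: ((g \o shift x) (h *: 1) - g x)) =
    (fun h : R => h^-1 * (g (h + x) - g x)).
  by apply/funext => h /=; rewrite [h *: 1]mulr1.
split=> [[dg <-]|C]; first by have := dg; rewrite /derivable /derive E.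
apply: DeriveDef; first by rewrite /derivable E; apply/cvg_ex; exists d.
by rewrite /derive E; exact/cvg_lim.
Qed.

Lemma is_derive_increment (R : realType) (g : R -> R) (x d : R) :
  is_derive x (1:R) g d <->
  (forall e, 0 < e -> \forall s \near (0:R)^', `|g (x + s) - g x - s * d| <= e * `|s|).
Proof.
have E e s : s != 0 ->
    (`|d - s^-1 * (g (s + x) - g x)| <= e) = (`|g (x + s) - g x - s * d| <= e * `|s|).
  move=> s0; have -> : d - s^-1 * (g (s + x) - g x) = - (g (x + s) - g x - s * d) / s.
    by rewrite [s + x]addrC; field.
  by rewrite normrM normrN normfV ler_pdivrMr ?normr_gt0.
have nz : \forall s \near (0:R)^', s != 0 by exact: nbhs_dnbhs_neq.
split=> [/is_deriveP/cvgrPdist_le H e e0|H].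
  by apply: filterS2 (H e e0) nz => s + s0; rewrite E.
apply/is_deriveP/cvgrPdist_le => e e0.
by apply: filterS2 (H e e0) nz => s + s0; rewrite E.
Qed.

Lemma MVT_norm_le_segment (R : realType) (g dg : R -> R) (a b K : R) :
  a <= b -> (forall x, x \in `[a, b] -> is_derive x (1:R) g (dg x)) ->
  (forall x, x \in `[a, b] -> `|dg x| <= K) -> `|g b - g a| <= K * (b - a).
Proof.
move=> ab D H.
have cg : {within `[a, b], continuous g}.
  by apply: derivable_within_continuous => x /D[].
have D' x : x \in `]a, b[ -> is_derive x (1:R) g (dg x).
  by move=> /subset_itv_oo_cc; exact: D.
have [c cab ->] := MVT_segment ab D' cg.
by rewrite normrM [`|b - a|]ger0_norm ?subr_ge0// ler_wpM2r ?subr_ge0// H.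
Qed.

Lemma MVT_norm_le (R : realType) (g dg : R -> R) (a b K : R) :
  (forall x, `|x - a| <= `|b - a| -> is_derive x (1:R) g (dg x)) ->
  (forall x, `|x - a| <= `|b - a| -> `|dg x| <= K) -> `|g b - g a| <= K * `|b - a|.
Proof.
move=> D H; have [ab|/ltW ba] := leP a b.
  rewrite [X in K * X]ger0_norm ?subr_ge0//.
  apply: (MVT_norm_le_segment ab) => x; rewrite in_itv/= => /andP[ax xb]; [apply: D|apply: H];
    by rewrite !ger0_norm ?subr_ge0// lerD2r.
rewrite distrC [`|b - a|]distrC [X in K * X]ger0_norm ?subr_ge0//.
apply: (MVT_norm_le_segment ba) => x; rewrite in_itv/= => /andP[bx xa]; [apply: D|apply: H];
  by rewrite ![`|_ - a|]distrC !ger0_norm ?subr_ge0// lerB.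
Qed.

(** A continuous partial derivative in one variable is enough for differentiability:
    the mean value theorem, applied in that variable to [Psi] minus its linear
    part, is uniform in the other one. *)
Lemma is_derive_two_var (R : realType) (Psi : R -> R -> R) (p : R * R -> R)
    (t x e a b : R) :
  {for (t, x), continuous p} ->
  (\forall z \near (t, x), is_derive z.1 (1:R) (Psi ^~ z.2) (p z)) ->
  is_derive x (1:R) (Psi t) e ->
  is_derive (0:R) (1:R) (fun s => Psi (t + s * a) (x + s * b)) (a * p (t, x) + b * e).
Proof.
move=> cp Dt Dx; apply/is_derive_increment => eps eps0.
have dxb : is_derive (0:R) (1:R) (fun s => Psi t (x + s * b)) (e * b).
  apply: (@der_comp _ (Psi t) (fun s => x + s * b)).
    by rewrite mul0r addr0.
  by der; rewrite /=; ring.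
set k := eps / 2 / (`|a| + 1).
have a1 : 0 < `|a| + 1 by rewrite ltr_wpDl.
have k0 : 0 < k by rewrite !divr_gt0.
have e2 : 0 < eps / 2 by rewrite divr_gt0.
have H1 := (is_derive_increment _ _ _).1 dxb _ e2.
have Hn : \forall z \near (t, x),
    is_derive z.1 (1:R) (Psi ^~ z.2) (p z) /\ `|p (t, x) - p z| <= k.
  by apply: filterI => //; exact: ((cvgrPdist_le _ _).1 cp).
have [r /= r0 Hr] := (nbhs_ballP _ _).1 Hn.
have ca : continuous_at (0:R) (fun s => `|s * a|) by cts.
have cb : continuous_at (0:R) (fun s => `|s * b|) by cts.
near=> s.
have sa : `|s * a| < r.
  by near: s; apply: nbhs_dnbhs; apply: (cvgr_lt _ ca); rewrite mul0r normr0.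
have sb : `|s * b| < r.
  by near: s; apply: nbhs_dnbhs; apply: (cvgr_lt _ cb); rewrite mul0r normr0.
rewrite add0r !mul0r !addr0.
have ball_in tau : `|tau - t| <= `|t + s * a - t| -> ball (t, x) r (tau, x + s * b).
  rewrite [t + _]addrC addrK => ht; split; rewrite /ball /= distrC.
    exact: le_lt_trans ht sa.
  by rewrite [x + _]addrC addrK.
have M1 : `|(Psi (t + s * a) (x + s * b) - (t + s * a) * p (t, x))
    - (Psi t (x + s * b) - t * p (t, x))| <= k * `|t + s * a - t|.
  apply: (@MVT_norm_le _ (fun tau => Psi tau (x + s * b) - tau * p (t, x))
    (fun tau => p (tau, x + s * b) - p (t, x))).
    move=> tau /ball_in/Hr[/= D _]; der; by rewrite /=; ring.
  by move=> tau /ball_in/Hr[/= _]; rewrite distrC.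
have H1s : `|Psi t (x + (0 + s) * b) - Psi t (x + 0 * b) - s * (e * b)| <= eps / 2 * `|s|.
  by near: s.
rewrite add0r mul0r addr0 in H1s.
have ka : k * `|a| <= eps / 2.
  by rewrite /k mulrAC ler_pdivrMr// ler_wpM2l ?(ltW e2)// lerDl.
have -> : Psi (t + s * a) (x + s * b) - Psi t x - s * (a * p (t, x) + b * e) =
  (Psi (t + s * a) (x + s * b) - (t + s * a) * p (t, x) - (Psi t (x + s * b) - t * p (t, x)))
  + (Psi t (x + s * b) - Psi t x - s * (e * b)) by ring.
apply: le_trans (ler_normD _ _) _.
have -> : eps * `|s| = eps / 2 * `|s| + eps / 2 * `|s| by field.
apply: lerD => //; apply: le_trans M1 _.
by rewrite [t + _]addrC addrK normrM [`|s| * _]mulrC mulrA ler_wpM2r.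
Unshelve. all: by end_near. Qed.

Lemma is_derive_nondecreasing (R : realType) (g dg : R -> R) (a b : R) :
  a <= b -> {within `[a, b], continuous g} ->
  (forall x, x \in `]a, b[ -> is_derive x (1:R) g (dg x)) ->
  (forall x, x \in `]a, b[ -> 0 <= dg x) -> g a <= g b.
Proof.
rewrite le_eqVlt => /predU1P[->//|ab] cg D H.
have [c cab E] := MVT ab D cg.
by rewrite -subr_ge0 E mulr_ge0 ?H// subr_ge0 ltW.
Qed.

Lemma is_derive_at0 (R : realType) (g : R -> R) (s d : R) :
  is_derive (0:R) (1:R) (fun r => g (s + r)) d -> is_derive s (1:R) g d.
Proof.
move=> /is_deriveP H; apply/is_deriveP; move: H.
by under eq_fun do rewrite !addr0 [s + _]addrC.
Qed.

(** * Waves driven by a conserved energy *)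

Section conservation_law.
Context (R : realType) (T M : R) (e et m mx : R * R -> R).
Local Notation mu := (@lebesgue_measure R).
Hypotheses (T0 : 0 < T) (ce : continuous e) (cet : continuous et)
  (cm : continuous m).
Hypothesis det : forall t x, t \in `]0, T[ -> Omega x ->
  is_derive t (1:R) (fun t => e (t, x)) (et (t, x)).
Hypothesis dmx : forall t x, t \in `]0, T[ -> Omega x ->
  is_derive x (1:R) (fun x => m (t, x)) (mx (t, x)).
Hypothesis law : forall t x, t \in `]0, T[ -> Omega x -> et (t, x) = - mx (t, x).
Hypothesis e_ge0 : forall t x, t \in `[0, T[ -> Omegabar x -> 0 <= e (t, x).
Hypothesis flux : forall t x, t \in `[0, T] -> bdOmega x -> `|m (t, x)| <= M.

(** A potential of the conservation law: its space derivative is [e] and its time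
    derivative is [- m] up to the flux at the left wall.  Energy fluxes through
    rays become increments of a single function. *)
Definition energy_left (t x : R) : R := \int[mu]_(y in `[0, x]) e (t, y).

Lemma energy_left_dt (t x : R) : t \in `]0, T[ -> 0 < x <= 1 ->
  is_derive t (1:R) (energy_left ^~ x) (m (t, 0) - m (t, x)).
Proof.
move=> tT /andP[x0 x1].
have inO y : y \in `]0, x[ -> Omega y.
  by rewrite /Omega /= !in_itv/= => /andP[-> yx] /=; exact: lt_le_trans x1.
have := @segment_param_derive R 0 x 0 T t e et ce cet tT _.
rewrite (_ : \int[_]_(_ in _) _ = m (t, 0) - m (t, x)).
  by apply=> s y sT /inO; exact: det.
have D y : y \in `]0, x[ -> is_derive y (1:R) (fun y => - m (t, y)) (et (t, y)).
  by move=> /inO yO; have D := dmx tT yO; rewrite law//; der.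
have c1 : continuous (fun y => - m (t, y)) by cts.
have c2 : continuous (fun y => et (t, y)) by cts.
by rewrite /Rintegral (segment_FTC2 x0 c1 c2 D)/= opprK addrC.
Qed.

Lemma energy_left_dx (t x : R) : 0 < x -> is_derive x (1:R) (energy_left t) (e (t, x)).
Proof.
move=> x0; have cet' : continuous (fun y => e (t, y)) by cts.
have [D1 D2] := @continuous_FTC1_closed R (fun y => e (t, y)) 0 x (x + 1)
   (ltr_pwDr ltr01 (lexx x)) (segment_integrable 0 (x + 1) cet') x0 (cet' x).
by apply: DeriveDef => //; rewrite -derive1E.
Qed.

Lemma energy_left_ray (t x a b : R) : t \in `]0, T[ -> Omega x ->
  is_derive (0:R) (1:R) (fun s => energy_left (t + s * a) (x + s * b))
    (a * (m (t, 0) - m (t, x)) + b * e (t, x)).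
Proof.
move=> tT xO; move: (xO); rewrite /Omega/= in_itv/= => /andP[x0 x1].
apply: (@is_derive_two_var _ energy_left (fun z => m (z.1, 0) - m z)).
- by cts.
- have : nbhs (t, x) (`]0, T[%classic `*` `]0, 1[%classic).
    by exists (`]0, T[%classic, `]0, 1[%classic) => //; split;
      apply: open_nbhs_nbhs; split => //; exact: interval_open.
  apply: filterS => -[s y] [/= sT]; rewrite in_itv/= => /andP[y0 y1].
  by apply: energy_left_dt => //; rewrite y0 ltW.
- exact: energy_left_dx.
Qed.

Lemma energy_left_ge0 (t x : R) : t \in `[0, T[ -> x <= 1 -> 0 <= energy_left t x.
Proof.
move=> tT x1; apply: Rintegral_ge0 => y /=; rewrite in_itv/= => /andP[y0 yx].
by apply: e_ge0 => //; rewrite /Omegabar/= in_itv/= y0 (le_trans yx).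
Qed.

Let e0 := \int[mu]_(y in `[0, 1]) e (0, y).

(** The total energy grows at rate at most [2 * M], the flux through both
    walls. *)
Lemma energy_left_le (t x : R) : t \in `[0, T[ -> x <= 1 ->
  energy_left t x <= e0 + 2 * M * t.
Proof.
move=> tT x1.
have cEt : continuous (energy_left ^~ 1) by exact: segment_param_continuous.
have cet' s : continuous (fun y => e (s, y)) by cts.
apply: (@le_trans _ _ (energy_left t 1)).
  have [x0|x0] := ltP 0 x.
    have cE : {within `[x, 1], continuous (energy_left t)}.
      apply: derivable_within_continuous => y; rewrite in_itv/= => /andP[xy _].
      by have [] := energy_left_dx t (lt_le_trans x0 xy).
    have dE y : y \in `]x, 1[ -> is_derive y (1:R) (energy_left t) (e (t, y)).
      by rewrite in_itv/= => /andP[xy _]; apply: energy_left_dx; exact: lt_trans xy.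
    apply: (is_derive_nondecreasing x1 cE dE) => y.
    rewrite in_itv/= => /andP[xy y1]; apply: e_ge0 => //.
    by rewrite /Omegabar/= in_itv/= !ltW// (lt_trans x0).
  suff -> : energy_left t x = 0 by exact: energy_left_ge0.
  rewrite /energy_left; move: x0; rewrite le_eqVlt => /predU1P[->|x0].
    by rewrite set_itv1 Rintegral_set1.
  by rewrite set_itv_ge ?Rintegral_set0// bnd_simp -ltNge.
move: tT; rewrite in_itv/= => /andP[t0 tT].
pose g s := 2 * M * s - energy_left s 1.
have -> : e0 = - g 0 by rewrite /g mulr0 sub0r opprK.
suff : g 0 <= g t by rewrite {2}/g; lra.
have cg : {within `[0, t], continuous g}.
  by apply: continuous_subspaceT; rewrite /g; cts.
have dg s : s \in `]0, t[ ->
    is_derive s (1:R) g (2 * M - (m (s, 0) - m (s, 1))).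
  rewrite in_itv/= => /andP[s0 st].
  have sT : s \in `]0, T[ by rewrite in_itv/= s0 (lt_trans st).
  have := @energy_left_dt s 1 sT; rewrite ltr01 lexx => /(_ isT) D.
  have D' : is_derive s (1:R) (fun s => 2 * M * s) (2 * M) by der; rewrite /=; ring.
  exact: (der_add D' (der_opp D)).
apply: (is_derive_nondecreasing t0 cg dg) => s; rewrite in_itv/= => /andP[s0 st].
have sT : s \in `[0, T] by rewrite in_itv/= !ltW// (lt_trans st).
have := flux sT (or_introl erefl); have := flux sT (or_intror erefl).
by rewrite !ler_norml => /andP[? ?] /andP[? ?]; lra.
Qed.

Context (W Wt Wx j : R * R -> R) (sg D : R).
Hypotheses (sg1 : sg = 1 \/ sg = -1) (WC : C1_rect T W Wt Wx).
Hypothesis transport_W : forall t x, t \in `]0, T[ -> Omega x ->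
  Wt (t, x) + sg * Wx (t, x) = - j (t, x).
Hypothesis j_le : forall t x, t \in `]0, T[ -> Omega x ->
  `|j (t, x)| <= e (t, x) - sg * m (t, x).
Hypothesis W_init : forall x, Omega x -> `|W (0, x)| <= D.
Hypothesis W_bd : forall t x, t \in `[0, T] -> bdOmega x -> `|W (t, x)| <= D.

(** Along the ray [s |-> (t - s, x - sg * s)] the derivative of
    [sg * energy_left] is minus the flux [e - sg * m] up to the flux at the left
    wall, and that of [W] is [j].  So [sg * energy_left] controls the variation of
    [W] in both directions, with errors [M * r] from the left wall and
    [2 * M * t] from the growth of the energy. *)
Lemma wave_increment (t x r : R) : t \in `]0, T[ -> Omega x -> 0 <= r < t ->
  Omega (x - sg * r) ->
  `|W (t, x) - W (t - r, x - sg * r)| <= e0 + 3 * T * M.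
Proof.
move=> tT xO /andP[r0 rt] xrO.
have M0 : 0 <= M.
  have zT : 0 \in `[0, T] by rewrite in_itv/= lexx ltW.
  exact: le_trans (normr_ge0 _) (flux zT (or_introl erefl)).
have ray s : s \in `[0, r] -> (t - s \in `]0, T[) /\ (Omega (x - sg * s)).
  move: tT xO xrO; rewrite /Omega /= !in_itv/= => /andP[tp tT] /andP[x0 x1] /andP[xr0 xr1].
  move=> /andP[s0 sr]; split; first by apply/andP; split; lra.
  by case: sg1 xr0 xr1 => -> ? ?; apply/andP; split; lra.
have [_ _ _ dW] := WC.
have sgsg : sg * sg = 1 by case: sg1 => ->; rewrite ?mulrNN mulr1.
(* [k] chooses the direction in which [W] is bounded *)
have incr k : k = 1 \/ k = -1 ->
    k * (W (t - r, x - sg * r) - W (t, x)) <=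
    sg * (energy_left t x - energy_left (t - r) (x - sg * r)) + M * r.
  move=> k1; pose G s := - (sg * energy_left (t - s) (x - sg * s) + M * (t - s)
    + k * W (t - s, x - sg * s)).
  pose dG s := let z := (t - s, x - sg * s) in
    (e z - sg * m z - k * j z) + (M + sg * m (t - s, 0)).
  have DG s : s \in `[0, r] -> is_derive s (1:R) G (dG s).
    move=> /ray[sT sO]; apply: is_derive_at0.
    have D1 := energy_left_ray (-1) (- sg) sT sO.
    have D2 := dW _ _ (-1) (- sg) sT sO.
    have D3 : is_derive (0:R) (1:R) (fun q => M * (t - s - q)) (- M).
      by der; rewrite /=; ring.
    have D4 := der_opp (der_add (der_add (der_mul (der_cst sg 0) D1) D3)
       (der_mul (der_cst k 0) D2)).
    have -> : (fun q => G (s + q)) = (fun q =>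
      - (sg * energy_left (t - s + q * -1) (x - sg * s + q * - sg) + M * (t - s - q)
        + k * W (t - s + q * -1, x - sg * s + q * - sg))).
      apply/funext => q; rewrite /G; have -> : t - (s + q) = t - s + q * -1 by ring.
      have -> : x - sg * (s + q) = x - sg * s + q * - sg by ring.
      by have -> : t - s - q = t - s + q * -1 by ring.
    apply: der_eq D4 _; rewrite /dG /=.
    have := transport_W sT sO; set z := (_, _) => Wz.
    have -> : -1 * Wt z + - sg * Wx z = j z by rewrite -[j z]opprK -Wz; ring.
    transitivity (sg * sg * e z - sg * m z - k * j z + (M + sg * m (t - s, 0))); first by ring.
    by rewrite sgsg mul1r.
  have cG : {within `[0, r], continuous G}.
    by apply: derivable_within_continuous => s /DG[].
  have DG' s : s \in `]0, r[ -> is_derive s (1:R) G (dG s).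
    by move=> /subset_itv_oo_cc; exact: DG.
  have : G 0 <= G r.
    apply: (is_derive_nondecreasing r0 cG DG') => s /subset_itv_oo_cc/ray[sT sO].
    rewrite /dG /= addr_ge0//.
      rewrite subr_ge0; apply: le_trans (j_le sT sO).
      by case: k1 => ->; rewrite ?mul1r ?mulN1r ?ler_norm// -normrN ler_norm.
    have sT' : t - s \in `[0, T] by exact: subset_itv_oo_cc.
    have := flux sT' (or_introl erefl); rewrite ler_norml => /andP[? ?].
    by case: sg1 => ->; lra.
  by rewrite /G !subr0 mulr0 subr0; lra.
have [rT' rO] : (t - r \in `[0, T[) /\ (x - sg * r <= 1).
  have r1 : r \in `[0, r] by rewrite in_itv/= r0 lexx.
  have [] := ray _ r1; rewrite /Omega /= !in_itv/= => /andP[/ltW -> ->] /andP[_ /ltW].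
  by [].
have [tT' x1] : (t \in `[0, T[) /\ (x <= 1).
  by move: tT xO; rewrite /Omega /= !in_itv/= => /andP[/ltW -> ->] /andP[_ /ltW].
have := energy_left_ge0 tT' x1; have := energy_left_ge0 rT' rO.
have := energy_left_le tT' x1; have := energy_left_le rT' rO.
have Mt : M * t <= M * T.
  by rewrite ler_wpM2l//; move: tT'; rewrite in_itv/= => /andP[_ /ltW].
have Mr : 0 <= M * r by rewrite mulr_ge0.
have Mrt : M * r <= M * t by rewrite ler_wpM2l// ltW.
have e00 : 0 <= e0 by apply: (@energy_left_ge0 0 1) => //; rewrite in_itv/= lexx.
have := incr 1 (or_introl erefl); have := incr (-1) (or_intror erefl).
rewrite mul1r mulN1r distrC ler_norml => H1 H2 H3 H4 H5 H6.
by apply/andP; split; case: sg1 H1 H2 H3 H4 H5 H6 => ->; rewrite ?mul1r ?mulN1r; lra.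
Qed.

(** The end of the backward ray may lie on the boundary of the domain, which is
    approached from inside by continuity of [W]. *)
Lemma wave_bound (t x : R) : t \in `]0, T[ -> Omega x ->
  `|W (t, x)| <= D + e0 + 3 * T * M.
Proof.
move=> tT xO; have [cW _ _ _] := WC.
have [t0 tT'] : 0 < t /\ t < T by apply/andP; move: tT; rewrite in_itv.
have [x0 x1] : 0 < x /\ x < 1 by apply/andP; move: xO; rewrite /Omega/= in_itv.
(* the time after which the backward ray leaves [Omega]: [x] or [1 - x] *)
pose xi := (1 - sg) / 2 + sg * x.
have xi0 : 0 < xi by rewrite /xi; case: sg1 => ->; lra.
pose r := Num.min t xi.
have r0 : 0 < r by rewrite lt_min t0.
have rt : r <= t by rewrite ge_min lexx.
have rxi : r <= xi by rewrite ge_min lexx orbT.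
have exit : `|W (t - r, x - sg * r)| <= D.
  have [txi|xit] := ltP t xi.
    have -> : r = t by apply/min_idPl/ltW.
    rewrite subrr; apply: W_init; move: txi; rewrite /xi /Omega /= in_itv/=.
    by case: sg1 => -> ?; apply/andP; split; lra.
  have rE : r = xi by apply/min_idPr.
  apply: W_bd; first by rewrite in_itv/=; apply/andP; split; lra.
  by rewrite rE /xi; case: sg1 => ->; [left|right] => /=; field.
rewrite leNgt; apply/negP => HW.
have cr : continuous_at r (fun s => `|W (t - s, x - sg * s)|) by cts.
have : \forall s \near r^'-, `|W (t - s, x - sg * s)| < `|W (t, x)| - (e0 + 3 * T * M).
  apply: (cvgr_lt _ (cvg_at_left_filter cr)); lra.
move=> near_r; near r^'- => s.
have sr : s < r by near: s; exact: nbhs_left_lt.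
have s0 : 0 < s by near: s; exact: nbhs_left_gt.
have Ws : `|W (t - s, x - sg * s)| < `|W (t, x)| - (e0 + 3 * T * M) by near: s.
have sO : Omega (x - sg * s).
  rewrite /Omega /= in_itv/=; move: rxi; rewrite /xi.
  by case: sg1 => -> ?; apply/andP; split; lra.
have st : 0 <= s < t by rewrite ltW//= (lt_le_trans sr).
have := wave_increment tT xO st sO.
have := ler_normD (W (t, x) - W (t - s, x - sg * s)) (W (t - s, x - sg * s)).
by rewrite subrK; lra.
Unshelve. all: by end_near. Qed.

End conservation_law.

(** * Moments of the density *)

Lemma itv_closure_le (R : realType) (g h : R -> R) (a b : R) :
  a < b -> continuous g -> continuous h ->
  (forall x, x \in `]a, b[ -> g x <= h x) -> forall x, x \in `[a, b] -> g x <= h x.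
Proof.
move=> ab cg ch H x; rewrite in_itv/= => /andP[ax xb].
rewrite leNgt; apply/negP => hg.
have cd : continuous (fun y => g y - h y) by cts.
have d0 : 0 < g x - h x by rewrite subr_gt0.
have [xlb|bx] := ltP x b.
  near x^'+ => y.
  have : 0 < g y - h y by near: y; exact: near_right_gt.
  rewrite subr_gt0 ltNge H// in_itv/=; apply/andP; split.
    by apply: le_lt_trans ax _; near: y; exact: nbhs_right_gt.
  by near: y; exact: nbhs_right_lt.
have xE : x = b by apply: le_anti; rewrite xb.
near x^'- => y.
have : 0 < g y - h y by near: y; apply: (cvgr_gt _ (cvg_at_left_filter (cd x))).
rewrite subr_gt0 ltNge H// in_itv/=; apply/andP; split.
  by near: y; apply: nbhs_left_gt; rewrite xE.
by rewrite -xE; near: y; exact: nbhs_left_lt.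
Unshelve. all: by end_near. Qed.

Lemma itv_closure_eq (R : realType) (g h : R -> R) (a b : R) :
  a < b -> continuous g -> continuous h ->
  (forall x, x \in `]a, b[ -> g x = h x) -> forall x, x \in `[a, b] -> g x = h x.
Proof.
move=> ab cg ch H x xab; apply: le_anti; apply/andP; split.
  by apply: (itv_closure_le ab cg ch) xab => y yab; rewrite H.
by apply: (itv_closure_le ab ch cg) xab => y yab; rewrite H.
Qed.

Section partial_derivatives.
Context (R : realType) (T : R).

Lemma rect_dt E Et Ex (t x : R) : C1_rect T E Et Ex -> t \in `]0, T[ -> Omega x ->
  is_derive t (1:R) (fun t => E (t, x)) (Et (t, x)).
Proof.
move=> [_ _ _ D] tT xO; apply: is_derive_at0.
have := D _ _ 1 0 tT xO; rewrite mul1r mul0r addr0.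
by under eq_fun do rewrite mulr1 mulr0 addr0.
Qed.

Lemma rect_dx E Et Ex (t x : R) : C1_rect T E Et Ex -> t \in `]0, T[ -> Omega x ->
  is_derive x (1:R) (fun x => E (t, x)) (Ex (t, x)).
Proof.
move=> [_ _ _ D] tT xO; apply: is_derive_at0.
have := D _ _ 0 1 tT xO; rewrite mul1r mul0r add0r.
by under eq_fun do rewrite mulr1 mulr0 addr0.
Qed.

Context (f ft fx f1 f2 : R * R * (R * R) -> R).
Hypothesis fC : C1_phase T f ft fx f1 f2.

Lemma phase_dt (t x : R) v : t \in `]0, T[ -> Omega x ->
  is_derive t (1:R) (fun t => f (t, x, v)) (ft (t, x, v)).
Proof.
move: v => [v1 v2] tT xO; apply: is_derive_at0; have [_ D] := fC.
have := D _ _ v1 v2 1 0 0 0 tT xO; rewrite mul1r !mul0r !addr0.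
by under eq_fun do rewrite mulr1 mulr0 !addr0.
Qed.

Lemma phase_dx (t x : R) v : t \in `]0, T[ -> Omega x ->
  is_derive x (1:R) (fun x => f (t, x, v)) (fx (t, x, v)).
Proof.
move: v => [v1 v2] tT xO; apply: is_derive_at0; have [_ D] := fC.
have := D _ _ v1 v2 0 1 0 0 tT xO; rewrite mul1r !mul0r !addr0 add0r.
by under eq_fun do rewrite mulr1 mulr0 !addr0.
Qed.

Lemma phase_d1 (t x v1 v2 : R) : t \in `]0, T[ -> Omega x ->
  is_derive v1 (1:R) (fun v1 => f (t, x, (v1, v2))) (f1 (t, x, (v1, v2))).
Proof.
move=> tT xO; apply: is_derive_at0; have [_ D] := fC.
have := D _ _ v1 v2 0 0 1 0 tT xO; rewrite mul1r !mul0r !addr0 !add0r.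
by under eq_fun do rewrite mulr1 mulr0 !addr0.
Qed.

Lemma phase_d2 (t x v1 v2 : R) : t \in `]0, T[ -> Omega x ->
  is_derive v2 (1:R) (fun v2 => f (t, x, (v1, v2))) (f2 (t, x, (v1, v2))).
Proof.
move=> tT xO; apply: is_derive_at0; have [_ D] := fC.
have := D _ _ v1 v2 0 0 0 1 tT xO; rewrite mul1r !mul0r !add0r.
by under eq_fun do rewrite mulr1 mulr0 !addr0.
Qed.

End partial_derivatives.

Section japanese_derivatives.
Context (R : realType).

Lemma is_derive_japanese1 (v1 v2 : R) :
  is_derive v1 (1:R) (fun v1 => japanese (v1, v2)) (vhat1 (v1, v2)).
Proof.
have j0 := japanese_gt0 (v1, v2); have j1 := j0; rewrite japaneseE /= in j1.
have -> : (fun v1 => japanese (v1, v2)) = (fun v1 => Num.sqrt (1 + v1 ^+ 2 + v2 ^+ 2)).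
  by apply/funext => w; rewrite japaneseE.
der; first by move: j1; rewrite /= sqrtr_gt0.
rewrite /vhat1 /= japaneseE /=; field; exact: lt0r_neq0.
Qed.

Lemma is_derive_japanese2 (v1 v2 : R) :
  is_derive v2 (1:R) (fun v2 => japanese (v1, v2)) (vhat2 (v1, v2)).
Proof.
have j0 := japanese_gt0 (v1, v2); have j1 := j0; rewrite japaneseE /= in j1.
have -> : (fun v2 => japanese (v1, v2)) = (fun v2 => Num.sqrt (1 + v1 ^+ 2 + v2 ^+ 2)).
  by apply/funext => w; rewrite japaneseE.
der; first by move: j1; rewrite /= sqrtr_gt0.
rewrite /vhat2 /= japaneseE /=; field; exact: lt0r_neq0.
Qed.

Lemma japanese_vhat1 (v : R * R) : japanese v * vhat1 v = v.1.
Proof. by rewrite /vhat1 mulrC divfK// gt_eqF// japanese_gt0. Qed.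

Lemma japanese_vhat2 (v : R * R) : japanese v * vhat2 v = v.2.
Proof. by rewrite /vhat2 mulrC divfK// gt_eqF// japanese_gt0. Qed.

(** After multiplication by [japanese v] this is [|v2| <= j ^ 2 - sg * v1 * j] for
    [j = japanese v], which holds since
    [2 * (j ^ 2 - sg * v1 * j - |v2|) = (j - sg * v1) ^ 2 + (1 - |v2|) ^ 2]. *)
Lemma vhat2_le_null (sg : R) (v : R * R) : sg = 1 \/ sg = -1 ->
  `|vhat2 v| <= japanese v - sg * v.1.
Proof.
move=> sg1; have j0 := japanese_gt0 v.
rewrite normrM normfV [`|japanese v|]gtr0_norm// ler_pdivrMr//.
have j2 := japanese_sqr v.
have sgsg : (sg * v.1) ^+ 2 = v.1 ^+ 2 by case: sg1 => ->; rewrite ?mul1r// mulN1r sqrrN.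
have a1 : 0 <= (japanese v - sg * v.1) ^+ 2 by exact: sqr_ge0.
have a2 : 0 <= (1 - `|v.2|) ^+ 2 by exact: sqr_ge0.
have a3 : `|v.2| ^+ 2 = v.2 ^+ 2 by rewrite real_normK ?num_real.
by move: a1 a2; rewrite !sqrrB !expr1n; nra.
Qed.

End japanese_derivatives.

Section moments.
Context (R : realType) (T L : R) (f ft fx f1 f2 : R * R * (R * R) -> R).
Hypothesis fC : C1_phase T f ft fx f1 f2.
Hypothesis L0 : 0 < L.
Hypothesis f_out : forall t x v, L <= enorm v -> f (t, x, v) = 0.

(** The integral over a square containing the support, so that continuity is
    enough for integrability and for derivation under the integral. *)
Definition moment (g : R * R * (R * R) -> R) (w : R * R -> R) (z : R * R) : R :=
  \int[lebesgue2]_(v in box L) (w v * g (z, v)).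

Lemma moment_continuous g w : continuous g -> continuous w -> continuous (moment g w).
Proof.
move=> cg cw; apply: (@box_param_continuous _ L _ (fun zv => w zv.2 * g zv)).
by cts.
Qed.

Lemma moment_dt w (t x : R) : continuous w -> t \in `]0, T[ -> Omega x ->
  is_derive t (1:R) (fun t => moment f w (t, x)) (moment ft w (t, x)).
Proof.
move=> cw tT xO; have [[cf cft _ _ _] _] := fC.
apply: (@box_param_derive _ L 0 T t (fun p => w p.2 * f (p.1, x, p.2))
  (fun p => w p.2 * ft (p.1, x, p.2))) => //; [by cts|by cts|].
move=> s v sT _; have D := phase_dt fC v sT xO.
by apply: der_eq (der_mul (der_cst (w v) s) D) _; rewrite /= mulr0 addr0.
Qed.

Lemma moment_dx w (t x : R) : continuous w -> t \in `]0, T[ -> Omega x ->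
  is_derive x (1:R) (fun x => moment f w (t, x)) (moment fx w (t, x)).
Proof.
move=> cw tT xO; have [[cf _ cfx _ _] _] := fC.
apply: (@box_param_derive _ L 0 1 x (fun p => w p.2 * f (t, p.1, p.2))
  (fun p => w p.2 * fx (t, p.1, p.2))) => //; [by cts|by cts|].
move=> y v yO _; have D := phase_dx fC v tT yO.
by apply: der_eq (der_mul (der_cst (w v) y) D) _; rewrite /= mulr0 addr0.
Qed.

Lemma moment_eq0 w t x : (forall v, f (t, x, v) = 0) -> moment f w (t, x) = 0.
Proof.
move=> H; have -> : moment f w (t, x) = \int[lebesgue2]_(v in box L) (cst 0 v).
  by apply: eq_Rintegral => v _; rewrite H mulr0.
by rewrite Rintegral_cst ?mul0r//; exact: box_measurable.
Qed.

Lemma moment_ge0 w t x : (forall v, 0 <= w v) -> (forall v, 0 <= f (t, x, v)) ->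
  0 <= moment f w (t, x).
Proof. by move=> w0 f0; apply: Rintegral_ge0 => v _; rewrite mulr_ge0. Qed.

Lemma moment_integral w t x : \int[lebesgue2]_v (w v * f (t, x, v)) = moment f w (t, x).
Proof.
rewrite /moment [RHS]Rintegral_mkcond; congr (Rintegral _ _ _); apply/funext => v.
rewrite patchE; case: ifPn => // /negP vL; rewrite f_out ?mulr0//.
by apply: not_box_enorm_ge => bv; apply: vL; exact: mem_set.
Qed.

Let box_lin (a b : R) (g h : R * R -> R) : continuous g -> continuous h ->
  \int[lebesgue2]_(v in box L) (a * g v + b * h v) =
  a * (\int[lebesgue2]_(v in box L) g v) + b * (\int[lebesgue2]_(v in box L) h v).
Proof.
move=> cg ch.
have cag : continuous (fun v => a * g v) by cts.
have cbh : continuous (fun v => b * h v) by cts.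
rewrite (@RintegralD _ _ R lebesgue2 (box L) _ _ (box_measurable L)
  (box_integrable L cag) (box_integrable L cbh)).
by rewrite !(@RintegralZl _ _ R lebesgue2 (box L) _ _ (box_measurable L))//;
  exact: box_integrable.
Qed.

Lemma moment_norm_le (w w2 w3 : R * R -> R) (c t x : R) :
  continuous w -> continuous w2 -> continuous w3 ->
  (forall v, `|w v| <= w2 v - c * w3 v) -> (forall v, 0 <= f (t, x, v)) ->
  `|moment f w (t, x)| <= moment f w2 (t, x) - c * moment f w3 (t, x).
Proof.
move=> cw cw2 cw3 H f0; have [[cf _ _ _ _] _] := fC.
have cg : continuous (fun v => w v * f (t, x, v)) by cts.
have cng : continuous (fun v => `|w v * f (t, x, v)|) by cts.
have cg2 : continuous (fun v => w2 v * f (t, x, v)) by cts.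
have cg3 : continuous (fun v => w3 v * f (t, x, v)) by cts.
have ch : continuous (fun v => 1 * (w2 v * f (t, x, v)) + - c * (w3 v * f (t, x, v))).
  by cts.
have -> : moment f w2 (t, x) - c * moment f w3 (t, x) = \int[lebesgue2]_(v in box L)
    (1 * (w2 v * f (t, x, v)) + - c * (w3 v * f (t, x, v))).
  by rewrite (box_lin 1 (- c) cg2 cg3) mul1r mulNr.
apply: (le_trans (@le_normr_Rintegral _ _ R lebesgue2 (box L) _ (box_measurable L)
  (box_integrable L cg))).
apply: (@le_Rintegral _ _ R lebesgue2 (box L) _ _ (box_measurable L)
  (box_integrable L cng) (box_integrable L ch)).
move=> v _; rewrite normrM [`|f _|]ger0_norm//.
rewrite mul1r mulrA -mulrDl ler_wpM2r// mulNr; exact: H.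
Qed.

Context (E1 E2 B : R * R -> R) (bext : R -> R).
Hypothesis vlasov : forall t x v, t \in `]0, T[ -> Omega x ->
  ft (t, x, v) + vhat1 v * fx (t, x, v) + force1 E1 B bext t x v * f1 (t, x, v)
  + force2 E2 B bext t x v * f2 (t, x, v) = 0.

(** Balance of the kinetic energy: the Vlasov equation multiplied by [japanese v]
    and integrated in [v].  As [japanese v * vhat1 v = v1], the magnetic part is
    the divergence of [f * b * (v2, - v1)] and integrates to zero; the electric part
    is integrated by parts with the gradient [(vhat1, vhat2)] of [japanese]. *)
Lemma moment_energy (t x : R) : t \in `]0, T[ -> Omega x ->
  moment ft (@japanese R) (t, x) + moment fx fst (t, x) =
  E1 (t, x) * moment f (@vhat1 R) (t, x) + E2 (t, x) * moment f (@vhat2 R) (t, x).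
Proof.
move=> tT xO; have [[cf cft cfx cf1 cf2] _] := fC.
have cj := @japanese_continuous R.
have c1 := @vhat1_continuous R; have c2 := @vhat2_continuous R.
set e1 := E1 (t, x); set e2 := E2 (t, x); set b := B (t, x) + bext x.
have out_lt u w : L <= `|u| \/ L <= `|w| -> f (t, x, (u, w)) = 0.
  by move=> [] h; apply/f_out/(le_trans h); [exact: (ler_enorm1 (u, w))|exact: (ler_enorm2 (u, w))].
have nL : L <= `|L| by rewrite ler_norm.
have nNL : L <= `|- L| by rewrite normrN ler_norm.
pose d1 v := (japanese v * e1 + v.2 * b) * f1 (t, x, v) + vhat1 v * e1 * f (t, x, v).
pose d2 v := (japanese v * e2 - v.1 * b) * f2 (t, x, v) + vhat2 v * e2 * f (t, x, v).
have cd1 : continuous d1 by rewrite /d1; cts.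
have cd2 : continuous d2 by rewrite /d2; cts.
have I1 : \int[lebesgue2]_(v in box L) d1 v = 0.
  pose A v := (japanese v * e1 + v.2 * b) * f (t, x, v).
  have cA : continuous A by rewrite /A; cts.
  apply: (box_divergence_1 L0 cA cd1).
  - move=> u w; have D1 := is_derive_japanese1 u w; have D2 := phase_d1 fC u w tT xO.
    by rewrite /A /=; der; rewrite /d1 /=; ring.
  - by move=> w; rewrite /A out_lt ?mulr0//; left.
  - by move=> w; rewrite /A out_lt ?mulr0//; left.
have I2 : \int[lebesgue2]_(v in box L) d2 v = 0.
  pose A v := (japanese v * e2 - v.1 * b) * f (t, x, v).
  have cA : continuous A by rewrite /A; cts.
  apply: (box_divergence_2 L0 cA cd2).
  - move=> u w; have D1 := is_derive_japanese2 u w; have D2 := phase_d2 fC u w tT xO.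
    by rewrite /A /=; der; rewrite /d2 /=; ring.
  - by move=> w; rewrite /A out_lt ?mulr0//; right.
  - by move=> w; rewrite /A out_lt ?mulr0//; right.
have cm (g : R * R * (R * R) -> R) (w : R * R -> R) :
  continuous g -> continuous w -> continuous (fun v => w v * g (t, x, v)) by move=> *; cts.
have cfst : continuous (@fst R R) by cts.
pose P1 v := japanese v * ft (t, x, v); pose P2 v := v.1 * fx (t, x, v).
pose Q1 v := vhat1 v * f (t, x, v); pose Q2 v := vhat2 v * f (t, x, v).
have cP1 : continuous P1 by exact: cm.
have cP2 : continuous P2 by exact: cm.
have cQ1 : continuous Q1 by exact: cm.
have cQ2 : continuous Q2 by exact: cm.
have cQ : continuous (fun v => e1 * Q1 v + e2 * Q2 v) by cts.
have cd : continuous (fun v => 1 * d1 v + 1 * d2 v) by cts.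
have -> : moment ft (@japanese R) (t, x) + moment fx fst (t, x) =
    \int[lebesgue2]_(v in box L) (1 * P1 v + 1 * P2 v).
  by rewrite (box_lin 1 1 cP1 cP2) !mul1r.
have -> : e1 * moment f (@vhat1 R) (t, x) + e2 * moment f (@vhat2 R) (t, x) =
    \int[lebesgue2]_(v in box L)
      (1 * (e1 * Q1 v + e2 * Q2 v) + (-1) * (1 * d1 v + 1 * d2 v)).
  rewrite (box_lin 1 (-1) cQ cd) (box_lin 1 1 cd1 cd2) I1 I2.
  by rewrite (box_lin e1 e2 cQ1 cQ2) !mulr0 !addr0 mulr0 addr0 mul1r.
apply: eq_Rintegral => v _.
have V := vlasov v tT xO; rewrite /force1 /force2 -/e1 -/e2 -/b in V.
have h1 := japanese_vhat1 v; have h2 := japanese_vhat2 v.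
rewrite /P1 /P2 /Q1 /Q2 /d1 /d2 -h1 -h2.
set J := japanese v in V *; set a1 := vhat1 v in V *; set a2 := vhat2 v in V *.
set g := f _; set gt := ft _ in V *; set gx := fx _ in V *.
set g1 := f1 _ in V *; set g2 := f2 _ in V *.
apply/eqP; rewrite -subr_eq0; apply/eqP.
by rewrite -[RHS](mulr0 J) -V; ring.
Qed.

End moments.

(** * Bounds on the electromagnetic field *)

Section fields.
Context (R : realType) (T L lam : R) (f ft fx f1 f2 : R * R * (R * R) -> R)
  (E1 E1t E1x E2 E2t E2x B Bt Bx : R * R -> R) (bext : R -> R).
Local Notation mu := (@lebesgue_measure R).
Hypotheses (T0 : 0 < T) (L0 : 0 < L).
Hypothesis fC : C1_phase T f ft fx f1 f2.
Hypothesis f_out : forall t x v, L <= enorm v -> f (t, x, v) = 0.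
Hypothesis f_ge0 : forall t x v, t \in `[0, T[ -> Omegabar x -> 0 <= f (t, x, v).
Hypothesis f_bd : forall t x v, bdOmega x -> f (t, x, v) = 0.
Hypothesis vlasov : forall t x v, t \in `]0, T[ -> Omega x ->
  ft (t, x, v) + vhat1 v * fx (t, x, v) + force1 E1 B bext t x v * f1 (t, x, v)
  + force2 E2 B bext t x v * f2 (t, x, v) = 0.
Hypotheses (E1C : C1_rect T E1 E1t E1x) (E2C : C1_rect T E2 E2t E2x)
  (BC : C1_rect T B Bt Bx).
Hypothesis ampere1 : forall t x, t \in `]0, T[ -> Omega x ->
  E1t (t, x) = - moment L f (@vhat1 R) (t, x).
Hypothesis gauss : forall t x, t \in `]0, T[ -> Omega x ->
  E1x (t, x) = moment L f (fun=> 1) (t, x).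
Hypothesis ampere2 : forall t x, t \in `]0, T[ -> Omega x ->
  E2t (t, x) = - Bx (t, x) - moment L f (@vhat2 R) (t, x).
Hypothesis faraday : forall t x, t \in `]0, T[ -> Omega x ->
  Bt (t, x) = - E2x (t, x).
Hypothesis E1_00 : E1 (0, 0) = lam.

Let cj := @japanese_continuous R.
Let c1 := @vhat1_continuous R.
Let c2 := @vhat2_continuous R.
Let cfst : continuous (@fst R R). Proof. by cts. Qed.
Let cone : continuous (fun _ : R * R => 1 : R). Proof. by move=> x; exact: cts_cst. Qed.
Let cf : continuous f. Proof. by have [[]] := fC. Qed.
Let cft : continuous ft. Proof. by have [[]] := fC. Qed.
Let cE1 : continuous E1. Proof. by have [] := E1C. Qed.
Let cE1t : continuous E1t. Proof. by have [] := E1C. Qed.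
Let cE2 : continuous E2. Proof. by have [] := E2C. Qed.
Let cE2t : continuous E2t. Proof. by have [] := E2C. Qed.
Let cE2x : continuous E2x. Proof. by have [] := E2C. Qed.
Let cB : continuous B. Proof. by have [] := BC. Qed.
Let cBt : continuous Bt. Proof. by have [] := BC. Qed.
Let cBx : continuous Bx. Proof. by have [] := BC. Qed.

(** The current [j1] vanishes at the walls.  The equation for [dt E1] is available
    in the interior only, so its integral form is carried to the walls. *)
Lemma E1_boundary (t b : R) : t \in `[0, T] -> bdOmega b -> E1 (t, b) = E1 (0, b).
Proof.
rewrite in_itv/= => /andP[t0 tT] bO; move: t0; rewrite le_eqVlt => /predU1P[<-//|t0].
have cj1 : continuous (moment L f (@vhat1 R)) by exact: moment_continuous.
have H x : x \in `]0, 1[ -> E1 (t, x) - E1 (0, x) =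
    - \int[mu]_(s in `[0, t]) moment L f (@vhat1 R) (s, x).
  move=> xO.
  have ce : continuous (fun s => - E1 (s, x)) by cts.
  have cm : continuous (fun s => moment L f (@vhat1 R) (s, x)) by cts.
  have D s : s \in `]0, t[ -> is_derive s (1:R) (fun s => - E1 (s, x))
      (moment L f (@vhat1 R) (s, x)).
    rewrite in_itv/= => /andP[s0 st].
    have sT : s \in `]0, T[ by rewrite in_itv/= s0 (lt_le_trans st).
    have D := rect_dt E1C sT xO.
    by apply: der_eq (der_opp D) _; rewrite ampere1// opprK.
  by rewrite /Rintegral (segment_FTC2 t0 ce cm D) /=; ring.
have cl : continuous (fun x => E1 (t, x) - E1 (0, x)) by cts.
have cr : continuous (fun x => - \int[mu]_(s in `[0, t]) moment L f (@vhat1 R) (s, x)).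
  have ci : continuous (fun x => \int[mu]_(s in `[0, t]) moment L f (@vhat1 R) (s, x)).
    apply: (@segment_param_continuous _ 0 t _ (fun z => moment L f (@vhat1 R) (z.2, z.1))).
    by cts.
  by move=> x; apply: cts_opp; exact: ci.
have bI : b \in `[0, 1] by rewrite in_itv/=; case: bO => ->; rewrite ?lexx ler01.
have := itv_closure_eq ltr01 cl cr H bI.
rewrite (_ : \int[_]_(_ in _) _ = 0) ?oppr0; first by move/subr0_eq.
have -> : \int[mu]_(s in `[0, t]) moment L f (@vhat1 R) (s, b) =
   \int[mu]_(s in `[0, t]) (cst 0 s).
  by apply: eq_Rintegral => s _; rewrite moment_eq0// => v; exact: f_bd.
by rewrite Rintegral_cst ?mul0r//; exact: measurable_itv.
Qed.

Let N := \int[mu]_(y in `[0, 1]) moment L f (fun=> 1) (0, y).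

Lemma E1_mass : E1 (0, 1) - E1 (0, 0) = N.
Proof.
have cr : continuous (moment L f (fun=> 1)) by exact: moment_continuous.
have ci : continuous (fun t => \int[mu]_(y in `[0, 1]) moment L f (fun=> 1) (t, y)).
  exact: segment_param_continuous.
have cl : continuous (fun t => E1 (t, 1) - E1 (t, 0)) by cts.
apply: (itv_closure_eq T0 cl ci); last by rewrite in_itv/= lexx ltW.
move=> t tT.
have ce : continuous (fun x => E1 (t, x)) by cts.
have cm : continuous (fun x => moment L f (fun=> 1) (t, x)) by cts.
have D (x : R) : x \in `]0, 1[ ->
    is_derive x (1:R) (fun x => E1 (t, x)) (moment L f (fun=> 1) (t, x)).
  by move=> xO; rewrite -gauss//; exact: rect_dx E1C tT xO.
by rewrite /Rintegral (segment_FTC2 ltr01 ce cm D).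
Qed.

Lemma E1_bound (t x : R) : t \in `[0, T] -> x \in `[0, 1] -> `|E1 (t, x)| <= N + `|lam|.
Proof.
move=> tT x01.
suff H s : s \in `]0, T[ -> `|E1 (s, x)| <= N + `|lam|.
  have ca : continuous (fun s => `|E1 (s, x)|) by cts.
  have cc : continuous (fun _ : R => N + `|lam|) by move=> ?; exact: cts_cst.
  exact: (itv_closure_le T0 ca cc H).
move=> sT.
have cr : continuous (moment L f (fun=> 1)) by exact: moment_continuous.
have ce : continuous (fun x => E1 (s, x)) by cts.
have mono (a b : R) : 0 <= a -> a <= b -> b <= 1 -> E1 (s, a) <= E1 (s, b).
  move=> a0 ab b1.
  have D y : y \in `]a, b[ -> is_derive y (1:R) (fun x => E1 (s, x)) (moment L f (fun=> 1) (s, y)).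
    rewrite in_itv/= => /andP[ay yb]; have yO : Omega y.
      by rewrite /Omega/= in_itv/= (le_lt_trans a0 ay) (lt_le_trans yb b1).
    by rewrite -gauss//; exact: rect_dx E1C sT yO.
  have cE : {within `[a, b], continuous (fun x => E1 (s, x))} by exact: continuous_subspaceT.
  apply: (is_derive_nondecreasing ab cE D) => y; rewrite in_itv/= => /andP[ay yb].
  apply: moment_ge0 => // v; apply: f_ge0; first exact: subset_itv_oo_co sT.
  by rewrite /Omegabar/= in_itv/= (le_trans a0 (ltW ay)) (le_trans (ltW yb) b1).
have sT' : s \in `[0, T] by exact: subset_itv_oo_cc sT.
have e0 := E1_boundary sT' (or_introl erefl : bdOmega (0 : R)).
have e1 := E1_boundary sT' (or_intror erefl : bdOmega (1 : R)).
move: x01; rewrite in_itv/= => /andP[x0 x1].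
have := mono _ _ (lexx 0) x0 x1; have := mono _ _ x0 x1 (lexx 1).
rewrite e0 e1 E1_00; have := E1_mass; rewrite E1_00 => h h1 h2.
have l1 := ler_norm lam; have l2 : - lam <= `|lam| by rewrite -normrN ler_norm.
by rewrite ler_norml; apply/andP; split; lra.
Qed.

Definition energy (z : R * R) : R :=
  moment L f (@japanese R) z + (E1 z ^+ 2 + E2 z ^+ 2 + B z ^+ 2) / 2.

Context (M D : R).
Hypothesis flux_bd : forall t x, t \in `[0, T] -> bdOmega x ->
  `|E2 (t, x) * B (t, x)| <= M.
Hypothesis init_D : forall x, Omega x -> `|E2 (0, x)| + `|B (0, x)| <= D.
Hypothesis bd_D : forall t x, t \in `[0, T] -> bdOmega x ->
  `|E2 (t, x)| + `|B (t, x)| <= D.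

(** [E2 + B] and [E2 - B] are handled together; [|E2| + |B|] is the larger of their
    moduli. *)
Lemma E2_B_bound (t x : R) : t \in `]0, T[ -> Omega x ->
  `|E2 (t, x)| + `|B (t, x)| <=
    D + \int[mu]_(y in `[0, 1]) energy (0, y) + 3 * T * M.
Proof.
move=> tT xO.
pose et z := moment L ft (@japanese R) z + (E1 z * E1t z + E2 z * E2t z + B z * Bt z).
pose m z := moment L f fst z + E2 z * B z.
pose mx z := moment L fx fst z + (E2x z * B z + E2 z * Bx z).
have cmj := @moment_continuous _ L _ _ cf cj; have cmjt := @moment_continuous _ L _ _ cft cj.
have cmf := @moment_continuous _ L _ _ cf cfst.
have ce : continuous energy by rewrite /energy; cts.
have cet : continuous et by rewrite /et; cts.
have cm : continuous m by rewrite /m; cts.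
have det s y : s \in `]0, T[ -> Omega y ->
    is_derive s (1:R) (fun s => energy (s, y)) (et (s, y)).
  move=> sT yO; have D1 := rect_dt E1C sT yO; have D2 := rect_dt E2C sT yO.
  have D3 := rect_dt BC sT yO; have D4 := moment_dt L fC cj sT yO.
  by rewrite /energy; der; rewrite /et /=; field.
have dmx s y : s \in `]0, T[ -> Omega y ->
    is_derive y (1:R) (fun y => m (s, y)) (mx (s, y)).
  move=> sT yO; have D2 := rect_dx E2C sT yO.
  have D3 := rect_dx BC sT yO; have D4 := moment_dx L fC cfst sT yO.
  by rewrite /m; der; rewrite /mx /=; ring.
have law s y : s \in `]0, T[ -> Omega y -> et (s, y) = - mx (s, y).
  move=> sT yO; rewrite /et /mx ampere1// ampere2// faraday//.
  have := moment_energy fC L0 f_out vlasov sT yO; lra.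
have k_ge0 s y : s \in `[0, T[ -> Omegabar y -> 0 <= moment L f (@japanese R) (s, y).
  move=> sT yO; apply: moment_ge0 => v; first exact/ltW/japanese_gt0.
  exact: f_ge0.
have e_ge0 s y : s \in `[0, T[ -> Omegabar y -> 0 <= energy (s, y).
  by move=> sT yO; rewrite addr_ge0 ?k_ge0// divr_ge0// !addr_ge0 ?sqr_ge0.
have flux s y : s \in `[0, T] -> bdOmega y -> `|m (s, y)| <= M.
  move=> sT yO; rewrite /m moment_eq0 ?add0r; first exact: flux_bd.
  by move=> v; exact: f_bd.
have wave sg : sg = 1 \/ sg = -1 -> `|E2 (t, x) + sg * B (t, x)| <=
    D + \int[mu]_(y in `[0, 1]) energy (0, y) + 3 * T * M.
  move=> sg1.
  pose W z := E2 z + sg * B z; pose Wt z := E2t z + sg * Bt z.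
  pose Wx z := E2x z + sg * Bx z.
  have sgn : `|sg| = 1 by case: sg1 => ->; rewrite ?normrN normr1.
  have WD z : `|W z| <= `|E2 z| + `|B z|.
    by rewrite (le_trans (ler_normD _ _))// normrM sgn mul1r.
  have WC : C1_rect T W Wt Wx.
    split; rewrite /W /Wt /Wx; [cts|cts|cts|].
    move=> s y a b sT yO.
    have [_ _ _ /(_ s y a b sT yO) D1] := E2C; have [_ _ _ /(_ s y a b sT yO) D2] := BC.
    by der; rewrite /=; ring.
  have sgsg : sg * sg = 1 by case: sg1 => ->; rewrite ?mulrNN mulr1.
  apply: (wave_bound T0 ce cet cm det dmx law e_ge0 flux sg1 WC
    (j := moment L f (@vhat2 R))) => //.
  - move=> s y sT yO; rewrite /Wt /Wx ampere2// faraday//.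
    transitivity (- moment L f (@vhat2 R) (s, y) + (sg * sg - 1) * Bx (s, y)); first by ring.
    by rewrite sgsg subrr mul0r addr0.
  - move=> s y sT yO.
    have fge v : 0 <= f (s, y, v).
      by apply: f_ge0; [exact: subset_itv_oo_co sT|exact: subset_itv_oo_cc yO].
    have := @moment_norm_le _ _ L _ _ _ _ _ fC _ _ _ sg s y c2 cj cfst
      (fun v => vhat2_le_null v sg1) fge.
    move=> /le_trans; apply; rewrite /energy /m.
    (* the field part of [e - sg * m] is [(E1 ^ 2 + (E2 - sg * B) ^ 2) / 2] *)
    have : 0 <= (E2 (s, y) - sg * B (s, y)) ^+ 2 by exact: sqr_ge0.
    have -> : (E2 (s, y) - sg * B (s, y)) ^+ 2 = E2 (s, y) ^+ 2
        + sg * sg * B (s, y) ^+ 2 - 2 * (sg * (E2 (s, y) * B (s, y))) by ring.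
    rewrite sgsg mul1r; have : 0 <= E1 (s, y) ^+ 2 by exact: sqr_ge0.
    by rewrite mulrDr; lra.
  - by move=> y yO; apply: le_trans (WD _) _; exact: init_D.
  - by move=> s y sT yO; apply: le_trans (WD _) _; exact: bd_D.
have := wave 1 (or_introl erefl); have := wave (-1) (or_intror erefl).
rewrite mul1r mulN1r !ler_norml => /andP[h1 h2] /andP[h3 h4].
by case: (ger0P (E2 (t, x))) => _; case: (ger0P (B (t, x))) => _; lra.
Qed.

End fields.

Lemma energy_integral_le (R : realType) (T L a b c : R) (f ft fx f1 f2 : R * R * (R * R) -> R)
    (E1 E2 B : R * R -> R) (t : R) :
  C1_phase T f ft fx f1 f2 -> continuous E1 -> continuous E2 -> continuous B ->
  (forall x, Omega x -> [/\ `|E1 (t, x)| <= a, `|E2 (t, x)| <= b & `|B (t, x)| <= c]) ->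
  \int[@lebesgue_measure R]_(x in `[0, 1]) energy L f E1 E2 B (t, x) <=
  \int[@lebesgue_measure R]_(x in `[0, 1]) moment L f (@japanese R) (t, x)
  + (a ^+ 2 + b ^+ 2 + c ^+ 2) / 2.
Proof.
move=> [[cf _ _ _ _] _] cE1 cE2 cB bd.
have cm := @moment_continuous _ L _ _ cf (@japanese_continuous R).
have cmx : continuous (fun x => moment L f (@japanese R) (t, x)) by cts.
have ce : continuous (fun x => energy L f E1 E2 B (t, x)) by rewrite /energy; cts.
pose q := (a ^+ 2 + b ^+ 2 + c ^+ 2) / 2.
have cq : continuous (fun _ : R => q) by move=> ?; exact: cts_cst.
have cmq : continuous (fun x => moment L f (@japanese R) (t, x) + q) by cts.
have iO (g : R -> R) : continuous g ->
    (@lebesgue_measure R).-integrable `]0, 1[ (EFin \o g).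
  by move=> cg; apply: integrableS (segment_integrable 0 1 cg) => //; exact: subset_itv_oo_cc.
rewrite !segment_integral_oo//.
apply: (@le_trans _ _ (\int[@lebesgue_measure R]_(x in `]0, 1[)
    (moment L f (@japanese R) (t, x) + q))).
  apply: le_Rintegral; [exact: measurable_itv|exact: iO|exact: iO|].
  move=> x /bd[x1 x2 x3]; rewrite /energy lerD2l ler_pM2r//.
  rewrite -(real_normK (num_real (E1 _))) -(real_normK (num_real (E2 _))).
  rewrite -(real_normK (num_real (B _))).
  by rewrite !lerD// lerXn2r ?nnegrE// (le_trans _ x1, le_trans _ x2, le_trans _ x3).
rewrite RintegralD//; [|exact: iO|exact: iO].
rewrite lerD2l (_ : \int[_]_(_ in _) q = q)//.
rewrite Rintegral_cst//= lebesgue_measure_itv/= lte_fin ltr01 -EFinB subr0 /=.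
by rewrite mulr1.
Qed.

(** The norms of the data are the initial mass and kinetic energy. *)
Lemma L1norm_moment (R : realType) (L : R) (f : R * R * (R * R) -> R)
    (f0 : R * (R * R) -> R) (w : R * R -> R) :
  continuous f -> continuous w -> (forall v, 0 <= w v) ->
  (forall x v, Omega x -> f (0, x, v) = f0 (x, v)) ->
  (forall z, phase z -> 0 <= f0 z) ->
  (forall x v, L <= enorm v -> f (0, x, v) = 0) ->
  L1norm (fun z => w z.2 * f0 z) =
  \int[@lebesgue_measure R]_(x in `[0, 1]) moment L f w (0, x).
Proof.
move=> cf cw w0 ff0 f00 fout.
apply: (@L1normE _ L _ (fun z => w z.2 * f (0, z.1, z.2))).
- by cts.
- by move=> [x v] [/= xO _]; rewrite ff0.
- by move=> z zO; rewrite mulr_ge0// f00.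
- by move=> x v /not_box_enorm_ge /fout ->; rewrite mulr0.
Qed.

(** * Pointwise bounds by the norms of the data *)

Section pointwise_Linfty.
Context (R : realType).

Lemma Linfty_ge0 (D : set R) (g : R -> R) : 0 <= Linfty D g.
Proof. by rewrite /Linfty fine_ge0// Lnorm_ge0. Qed.

Lemma L1norm_ge0 (g : R * (R * R) -> R) : 0 <= L1norm g.
Proof. by rewrite /L1norm fine_ge0// Lnorm_ge0. Qed.

Lemma Linfty_itv_ge (a b x : R) (D : set R) (g : R -> R) : a <= b ->
  {within `[a, b], continuous g} -> D `<=` `[a, b] -> nbhs x D ->
  `|g x| <= Linfty D g.
Proof.
move=> ab cg Dab Dx.
have cgc : continuous (g \o clamp a b).
  apply: (continuous_comp_within cg); first exact: clamp_continuous.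
  by move=> y; exact: clamp_itv.
have [M HM] := compact_bounded (@segment_compact R a b) cgc.
have gE y : y \in `[a, b] -> (g \o clamp a b) y = g y by move=> yab; rewrite /= clamp_id.
apply: (@Linfty_ge _ _ _ _ M) => //.
  by move=> y /Dab yab; rewrite -gE//; exact: HM.
have xab := nbhs_singleton Dx.
rewrite /prop_for /continuous_at -gE; last exact: Dab.
apply: cvg_trans (cgc x); apply: near_eq_cvg.
by apply: filterS Dx => y /Dab; exact: gE.
Qed.

(** At the endpoints, which have no neighbourhood in the interval, by continuity. *)
Lemma Linfty_cc_ge (a b x : R) (g : R -> R) : a < b ->
  {within `[a, b], continuous g} -> x \in `[a, b] -> `|g x| <= Linfty `[a, b] g.
Proof.
move=> ab cg.
have cgc : continuous (g \o clamp a b).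
  apply: (continuous_comp_within cg); first exact: clamp_continuous.
  by move=> y; apply: clamp_itv; exact: ltW.
have c1 : continuous (fun y => `|(g \o clamp a b) y|) by cts.
have c2 : continuous (fun _ : R => Linfty `[a, b] g) by move=> ?; exact: cts_cst.
move=> xab; have := itv_closure_le ab c1 c2 _ xab; rewrite /= clamp_id//; apply.
move=> y yab; rewrite clamp_id; last exact: subset_itv_oo_cc yab.
apply: (Linfty_itv_ge (ltW ab) cg) => //.
have : nbhs y `]a, b[%classic by apply: open_nbhs_nbhs; split => //; exact: interval_open.
by apply: filterS; exact: subset_itv_oo_cc.
Qed.

Lemma Linfty_bd_ge (T t b : R) (g : R -> R -> R) : 0 < T ->
  (forall b, bdOmega b -> {within `[0, T], continuous (g ^~ b)}) ->
  t \in `[0, T] -> bdOmega b -> `|g t b| <= Linfty_bd T g.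
Proof.
move=> T0 cg tT bO; have := Linfty_cc_ge T0 (cg _ bO) tT.
by rewrite /Linfty_bd le_max; case: bO => -> ->; rewrite ?orbT.
Qed.

End pointwise_Linfty.

(** * Distance to the walls *)

Section distance.
Context (R : realType).

Lemma edist_inf_Omega (x : R) : Omega x ->
  exists2 r : R, 0 < r & edist_inf (@bdOmega R) x = r%:E.
Proof.
rewrite /Omega /= in_itv/= => /andP[x0 x1].
have lb : ((Num.min x (1 - x))%:E <= edist_inf (@bdOmega R) x)%E.
  apply: le_ereal_inf_tmp => _ [a aO <-].
  apply: le_ereal_inf_tmp => _ [r [r0 xr] <-]; rewrite lee_fin.
  move: xr; rewrite /ball /= => /ltW; apply: le_trans.
  case: aO => ->; first by rewrite subr0 gtr0_norm// ge_min lexx.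
  by rewrite distrC gtr0_norm ?subr_gt0// ge_min lexx orbT.
have ub : (edist_inf (@bdOmega R) x <= 1%:E)%E.
  apply: ge_ereal_inf; exists (edist (x, 0)); first by exists 0 => //; left.
  by apply: edist_fin => //; rewrite /ball /= subr0 gtr0_norm.
have fin : edist_inf (@bdOmega R) x \is a fin_num.
  by rewrite ge0_fin_numE ?edist_inf_ge0// (le_lt_trans ub)// ltry.
exists (fine (edist_inf (@bdOmega R) x)); last by rewrite fineK.
by rewrite -lte_fin fineK// (lt_le_trans _ lb)// lte_fin lt_min x0 subr_gt0 x1.
Qed.

Lemma dist_bd_lower (A : set R) (gamma b : R) : 0 < gamma -> 0 < b ->
  (forall x, A x -> exists2 r, 0 < r &
     edist_inf (@bdOmega R) x = r%:E /\ b <= r `^ gamma) ->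
  (b%:E <= dist_bd A `^ gamma)%E.
Proof.
move=> g0 b0 H.
have bE : b = (b `^ gamma^-1) `^ gamma by rewrite -powRrM mulVf ?gt_eqF// powRr1// ltW.
have d : ((b `^ gamma^-1)%:E <= dist_bd A)%E.
  apply: le_ereal_inf_tmp => _ [x Ax <-]; have [r r0 [-> br]] := H x Ax.
  rewrite lee_fin -[leRHS](powRr1 (ltW r0)) -(mulfV (lt0r_neq0 g0)) powRrM.
  by apply: ge0_ler_powR => //; rewrite ?nnegrE ?invr_ge0 ?powR_ge0// ltW.
rewrite {1}bE -poweR_EFin gt0_ler_poweR ?(ltW g0)// ?in_itv/= ?lee_fin ?powR_ge0 ?leey//.
by rewrite andbT (le_trans _ d)// lee_fin powR_ge0.
Qed.

End distance.

(** * The constants *)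

Section constants.
Context (R : realType) (f0 : R * (R * R) -> R) (lam : R) (E20 B0 : R -> R)
  (E2b Bb : R -> R -> R) (T : R).
Hypothesis T0 : 0 <= T.
Local Notation C1 := (C1const f0 lam E20 B0 E2b Bb T).
Local Notation C2 := (C2const f0 lam E20 B0 E2b Bb T).

Lemma Linfty_bd_ge0 (g : R -> R -> R) : 0 <= Linfty_bd T g.
Proof. by rewrite /Linfty_bd le_max Linfty_ge0. Qed.

(** The left-hand side bounds [|E2| + |B|]: boundary and initial data, initial
    energy, and flux through the walls. *)
Lemma C1const_ge :
  (Linfty Omega E20 + Linfty_bd T E2b + Linfty Omega B0 + Linfty_bd T Bb)
  + (L1norm (fun z => japanese z.2 * f0 z)
     + ((L1norm f0 + `|lam|) ^+ 2 + Linfty Omega E20 ^+ 2 + Linfty Omega B0 ^+ 2) / 2)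
  + 3 * T * Linfty_bd T (fun t x => E2b t x * Bb t x) <= 3 * C1.
Proof.
rewrite /C1const.
have := Linfty_ge0 Omega E20; have := Linfty_ge0 Omega B0.
have := Linfty_bd_ge0 E2b; have := Linfty_bd_ge0 Bb.
have := L1norm_ge0 (fun z => japanese z.2 * f0 z).
have := sqr_ge0 (L1norm f0 + `|lam|).
have := sqr_ge0 (Linfty Omega E20); have := sqr_ge0 (Linfty Omega B0).
lra.
Qed.

Lemma C1const_ge0 : 0 <= C1.
Proof.
rewrite -(@pmulr_rge0 _ 3)//; apply: le_trans C1const_ge.
by rewrite !addr_ge0 ?mulr_ge0 ?addr_ge0 ?sqr_ge0 ?Linfty_ge0 ?Linfty_bd_ge0 ?L1norm_ge0.
Qed.

Lemma C2const_ge : L1norm f0 + `|lam| + 3 * C1 <= C2.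
Proof.
rewrite /C2const; have := C1const_ge0; have := L1norm_ge0 f0; have := normr_ge0 lam.
lra.
Qed.

Lemma C1const_le_C2const : 3 * C1 <= C2.
Proof. by apply: le_trans C2const_ge; rewrite lerDr addr_ge0 ?L1norm_ge0. Qed.

End constants.

(** * Confinement *)

Theorem lemma3p4 (R : realType)
    (psi_ext : R -> R) (gamma c0 : R)
    (f0 : R * (R * R) -> R) (lam : R) (E20 B0 : R -> R) (E2b Bb : R -> R -> R)
    (hpsi : C1_on Omega psi_ext) (hpsi' : C1_on Omega (derive1 psi_ext))
    (hgamma : 0 < gamma) (hc0 : 0 < c0)
    (hpsi_lb : forall x, Omega x ->
      (c0%:E * edist_inf bdOmega x `^ (- gamma) - (c0^-1)%:E
         <= `|psi_ext x|%:E)%E)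
    (hf0 : C1_compact_support f0)
    (hf0_ge0 : forall z, phase z -> 0 <= f0 z)
    (hE20 : C1_on Omegabar E20) (hB0 : C1_on Omegabar B0)
    (T : R) (hT : 0 < T)
    (hE2b : forall x, bdOmega x -> C1_on `[0, T] (E2b ^~ x))
    (hBb : forall x, bdOmega x -> C1_on `[0, T] (Bb ^~ x))
    (f : R * R * (R * R) -> R) (E1 E2 B : R * R -> R)
    (hsol : is_C1_RVM_solution psi_ext f0 lam E20 B0 E2b Bb T f E1 E2 B)
    (hf_bd : forall t x v, t \in `[0, T] -> bdOmega x -> f (t, x, v) = 0)
    (eps0 k0 : R) (heps0 : 0 < eps0) (hk0 : 0 < k0)
    (hspt : spt f0 `<=` [set z | z.1 \in `[eps0, 1 - eps0] /\ enorm z.2 <= k0]) :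
  let C1 := C1const f0 lam E20 B0 E2b Bb T in
  let C2 := C2const f0 lam E20 B0 E2b Bb T in
  forall t, t \in `[0, T] ->
    (P f t <= (k0 + C2 * t)%:E)%E /\
    ((c0 / (c0^-1 + 2 * k0 + C1 + 3 * C2 * t
            + Linfty `[eps0, 1 - eps0] psi_ext))%:E
       <= dist_bd (Sigma f t) `^ gamma)%E.
Proof.
move=> C1 C2.
have [fC1 E1C1 E2C1 BC1 Vl dtE1 dxE1 dtE2 dtB inf inE2 inB inE1 bdE2 bdB] := hsol.
have [ft [fx [f1 [f2 [fC fD]]]]] := C1_on_phase hT fC1.
have [E1t [E1x [E1C E1D]]] := C1_on_rect hT E1C1.
have [E2t [E2x [E2C E2D]]] := C1_on_rect hT E2C1.
have [Bt [Bx [BC BD]]] := C1_on_rect hT BC1.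
set F := f \o clamp_phase T in fC; set e1 := E1 \o clamp_rect T in E1C.
set e2 := E2 \o clamp_rect T in E2C; set b := B \o clamp_rect T in BC.
have zT : 0 \in `[0, T] by rewrite in_itv/= lexx ltW.
have ooT t : t \in `]0, T[ -> t \in `[0, T] by exact: subset_itv_oo_cc.
have OO (x : R) : Omega x -> Omegabar x by exact: subset_itv_oo_cc.
have bO (x : R) : bdOmega x -> Omegabar x.
  by rewrite /Omegabar /= in_itv/= => -[] ->; rewrite ?lexx ler01.
have FE t x v : t \in `[0, T] -> Omegabar x -> F (t, x, v) = f (t, x, v).
  by move=> tT xO; rewrite /F /= /clamp_phase /= clamp_rect_id.
have e1E t x : t \in `[0, T] -> Omegabar x -> e1 (t, x) = E1 (t, x).
  by move=> tT xO; rewrite /e1 /= clamp_rect_id.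
have e2E t x : t \in `[0, T] -> Omegabar x -> e2 (t, x) = E2 (t, x).
  by move=> tT xO; rewrite /e2 /= clamp_rect_id.
have bE t x : t \in `[0, T] -> Omegabar x -> b (t, x) = B (t, x).
  by move=> tT xO; rewrite /b /= clamp_rect_id.
pose bext := derive1 psi_ext.
have Fbd t x v : bdOmega x -> F (t, x, v) = 0.
  move=> xb; rewrite /F /= /clamp_phase /clamp_rect /= (clamp_id (bO _ xb)).
  by apply: hf_bd => //; apply: clamp_itv; exact: ltW.
have vlasov t x v : t \in `]0, T[ -> Omega x ->
    ft (t, x, v) + vhat1 v * fx (t, x, v) + force1 e1 b bext t x v * f1 (t, x, v)
    + force2 e2 b bext t x v * f2 (t, x, v) = 0.
  move=> tT xO; have := Vl t x v tT xO; have [-> -> -> ->] := fD _ _ v tT xO.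
  have tT' := ooT _ tT; have xO' := OO _ xO.
  by rewrite /force1 /force2 (e1E _ _ tT' xO') (e2E _ _ tT' xO') (bE _ _ tT' xO').
have Finit x v : Omega x -> F (0, x, v) = f0 (x, v).
  by move=> xO; rewrite (FE _ _ _ zT (OO _ xO)) inf.
have Fspt x v : Omega x -> F (0, x, v) != 0 -> x \in `[eps0, 1 - eps0] /\ enorm v <= k0.
  move=> xO; rewrite Finit// => f0n.
  by apply: (hspt (x, v)); apply: subset_closure; split => //; split.
have dpsi x : Omega x -> is_derive x (1:R) psi_ext (bext x).
  move=> xO; have [_ /(_ x) dp _] := hpsi.
  apply: DeriveDef; last by rewrite /bext derive1E.
  apply/diff_derivable/dp; rewrite /interior.
  by apply: open_nbhs_nbhs; split => //; exact: interval_open.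
have [[cF _ _ _ _] _] := fC; have [ce1 _ _ _] := E1C; have [ce2 _ _ _] := E2C.
have [cb _ _ _] := BC.
(* a crude bound on the support, from compactness, places it in a fixed square *)
have ce12 : continuous (fun z => `|e1 z| + `|e2 z|) by cts.
have [C HC] := compact_bounded
  (compact_setX (@segment_compact R 0 T) (@segment_compact R 0 1)) ce12.
have HC' t x : t \in `]0, T[ -> Omega x -> `|e1 (t, x)| + `|e2 (t, x)| <= C.
  move=> tT xO; apply: le_trans (ler_norm _) _; apply: HC.
  by split; [exact: ooT|exact: OO].
have C0 : 0 <= C.
  have tT : T / 2 \in `]0, T[ by rewrite in_itv/=; apply/andP; split; lra.
  have xO : Omega (2^-1 : R) by rewrite /Omega /= in_itv/=; apply/andP; split; lra.
  exact: le_trans (HC' _ _ tT xO).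
have k00 := ltW hk0.
have supp t x v : t \in `[0, T] -> Omega x -> F (t, x, v) != 0 -> enorm v <= k0 + C * t.
  apply: (transport_momentum_bound hT fC vlasov Fbd k00 C0 HC').
  by move=> y w yO /(Fspt _ _ yO)[].
pose K := k0 + C * T.
have Fsupp t x v : K < enorm v -> F (t, x, v) = 0.
  move=> Kv; apply/eqP; apply: contraTT Kv => Fn0; rewrite -leNgt.
  have tT := clamp_itv t (ltW hT); have x1 := clamp_itv x (@ler01 R).
  have FF : F (t, x, v) = F (clamp 0 T t, clamp 0 1 x, v).
    by rewrite (FE _ _ v tT x1).
  have [xb|xO] : bdOmega (clamp 0 1 x) \/ Omega (clamp 0 1 x).
    move: x1; rewrite /Omega /= !in_itv/= => /andP[].
    rewrite le_eqVlt => /predU1P[<- _|-> /=]; first by left; left.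
    by rewrite le_eqVlt => /predU1P[->|->]; [left; right|right].
  - by move: Fn0; rewrite FF Fbd// eqxx.
  - rewrite FF in Fn0; apply: le_trans (supp _ _ _ tT xO Fn0) _.
    rewrite lerD2l ler_wpM2l//.
    by move: tT; rewrite in_itv/= => /andP[].
have F0_ge0 x v : Omega x -> 0 <= F (0, x, v).
  by move=> xO; rewrite Finit// hf0_ge0.
have F_ge0 t x v : t \in `[0, T[ -> Omegabar x -> 0 <= F (t, x, v).
  exact: (transport_ge0 fC vlasov Fbd F0_ge0 Fsupp).
pose L := K + 1.
have K0 : 0 <= K by rewrite addr_ge0// mulr_ge0// ltW.
have L0 : 0 < L by rewrite ltr_wpDl.
have Fout t x v : L <= enorm v -> F (t, x, v) = 0.
  by move=> Lv; apply: Fsupp; apply: lt_le_trans Lv; rewrite ltrDl.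
have Mf t x (w : R * R -> R) : t \in `]0, T[ -> Omega x ->
    \int[lebesgue2]_v (w v * f (t, x, v)) = moment L F w (t, x).
  move=> tT xO; rewrite -(moment_integral Fout); congr (Rintegral _ _ _).
  by apply/funext => v; rewrite (FE _ _ _ (ooT _ tT) (OO _ xO)).
have ampere1 t x : t \in `]0, T[ -> Omega x -> E1t (t, x) = - moment L F (@vhat1 R) (t, x).
  by move=> tT xO; rewrite -Mf// -(E1D _ _ tT xO).1 dtE1.
have gauss t x : t \in `]0, T[ -> Omega x -> E1x (t, x) = moment L F (fun=> 1) (t, x).
  move=> tT xO; rewrite -Mf// -(E1D _ _ tT xO).2 dxE1// /rho; congr (Rintegral _ _ _).
  by apply/funext => v; rewrite mul1r.
have ampere2 t x : t \in `]0, T[ -> Omega x ->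
    E2t (t, x) = - Bx (t, x) - moment L F (@vhat2 R) (t, x).
  by move=> tT xO; rewrite -Mf// -(E2D _ _ tT xO).1 -(BD _ _ tT xO).2 dtE2.
have faraday t x : t \in `]0, T[ -> Omega x -> Bt (t, x) = - E2x (t, x).
  by move=> tT xO; rewrite -(E2D _ _ tT xO).2 -(BD _ _ tT xO).1 dtB.
have e100 : e1 (0, 0) = lam by rewrite (e1E _ _ zT (bO _ (or_introl erefl))).
set N := L1norm f0 in C1 C2 *; set J := L1norm (fun z => japanese z.2 * f0 z) in C1 C2 *.
have JE : J = \int[@lebesgue_measure R]_(x in `[0, 1]) moment L F (@japanese R) (0, x).
  apply: L1norm_moment => //; first exact: japanese_continuous.
  - by move=> v; exact/ltW/japanese_gt0.
  - by move=> x v; exact: Fout.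
have NE : N = \int[@lebesgue_measure R]_(x in `[0, 1]) moment L F (fun=> 1) (0, x).
  rewrite -(L1norm_moment (f0 := f0))//.
  - by rewrite /N; congr L1norm; apply/funext => z; rewrite mul1r.
  - by move=> ?; exact: cts_cst.
  - by move=> x v; exact: Fout.
set d1 := Linfty Omega E20 in C1 C2 *; set d2 := Linfty_bd T E2b in C1 C2 *.
set d3 := Linfty Omega B0 in C1 C2 *; set d4 := Linfty_bd T Bb in C1 C2 *.
set M := Linfty_bd T (fun t x => E2b t x * Bb t x) in C1 C2 *.
have nbdO (x : R) : Omega x -> nbhs x (@Omega R).
  by move=> xO; apply: open_nbhs_nbhs; split => //; exact: interval_open.
have e20 x : Omega x -> `|e2 (0, x)| <= d1.
  move=> xO; rewrite (e2E _ _ zT (OO _ xO)) inE2; last exact: OO.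
  by have [cE _ _] := hE20; apply: (Linfty_itv_ge ler01 cE) => //; exact: nbdO.
have b0 x : Omega x -> `|b (0, x)| <= d3.
  move=> xO; rewrite (bE _ _ zT (OO _ xO)) inB; last exact: OO.
  by have [cB _ _] := hB0; apply: (Linfty_itv_ge ler01 cB) => //; exact: nbdO.
have e2b t x : t \in `[0, T] -> bdOmega x -> e2 (t, x) = E2b t x.
  by move=> tT xb; rewrite (e2E _ _ tT (bO _ xb)) bdE2.
have bb t x : t \in `[0, T] -> bdOmega x -> b (t, x) = Bb t x.
  by move=> tT xb; rewrite (bE _ _ tT (bO _ xb)) bdB.
have cE2b x : bdOmega x -> {within `[0, T], continuous (E2b ^~ x)} by case/hE2b.
have cBb x : bdOmega x -> {within `[0, T], continuous (Bb ^~ x)} by case/hBb.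
have flux t x : t \in `[0, T] -> bdOmega x -> `|e2 (t, x) * b (t, x)| <= M.
  move=> tT xb; rewrite e2b// bb//.
  apply: (Linfty_bd_ge (g := fun t x => E2b t x * Bb t x)) => // y yb.
  by move=> z; apply: continuousM; [exact: cE2b|exact: cBb].
have bdD t x : t \in `[0, T] -> bdOmega x ->
    `|e2 (t, x)| + `|b (t, x)| <= d1 + d2 + d3 + d4.
  move=> tT xb; rewrite e2b// bb//.
  apply: le_trans (lerD (Linfty_bd_ge hT cE2b tT xb) (Linfty_bd_ge hT cBb tT xb)) _.
  rewrite -subr_ge0 (_ : _ - _ = d1 + d3); last by rewrite /d1 /d2 /d3 /d4; ring.
  by rewrite addr_ge0 ?Linfty_ge0.
have initD x : Omega x -> `|e2 (0, x)| + `|b (0, x)| <= d1 + d2 + d3 + d4.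
  move=> xO; apply: le_trans (lerD (e20 _ xO) (b0 _ xO)) _.
  rewrite -subr_ge0 (_ : _ - _ = d2 + d4); last by ring.
  by rewrite addr_ge0 ?Linfty_bd_ge0.
have e1b t x : t \in `[0, T] -> Omegabar x -> `|e1 (t, x)| <= N + `|lam|.
  move=> tT xO; rewrite NE.
  exact: (E1_bound hT fC F_ge0 Fbd E1C ampere1 gauss e100 tT xO).
have en0 : \int[@lebesgue_measure R]_(y in `[0, 1]) energy L F e1 e2 b (0, y) <=
    J + ((N + `|lam|) ^+ 2 + d1 ^+ 2 + d3 ^+ 2) / 2.
  rewrite JE; have H := @energy_integral_le _ T L (N + `|lam|) d1 d3
    F ft fx f1 f2 e1 e2 b 0 fC ce1 ce2 cb.
  apply: H => x xO.
  by split; [exact: e1b zT (OO _ xO)|exact: e20|exact: b0].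
have C10 : 0 <= C1 by apply: C1const_ge0; exact: ltW.
have C1C2 : 3 * C1 <= C2 by apply: C1const_le_C2const; exact: ltW.
have C20 : 0 <= C2 by apply: le_trans C1C2; rewrite mulr_ge0.
have C1ge : (d1 + d2 + d3 + d4)
    + (J + ((N + `|lam|) ^+ 2 + d1 ^+ 2 + d3 ^+ 2) / 2) + 3 * T * M <= 3 * C1.
  by apply: C1const_ge; exact: ltW.
have C2ge : N + `|lam| + 3 * C1 <= C2 by apply: C2const_ge; exact: ltW.
have e2bB t x : t \in `]0, T[ -> Omega x -> `|e2 (t, x)| + `|b (t, x)| <= 3 * C1.
  move=> tT xO; apply: le_trans C1ge.
  apply: le_trans (E2_B_bound hT L0 fC Fout F_ge0 Fbd vlasov E1C E2C BC
    ampere1 ampere2 faraday flux initD bdD tT xO) _.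
  by rewrite lerD2r lerD2l.
have e1e2 t x : t \in `]0, T[ -> Omega x -> `|e1 (t, x)| + `|e2 (t, x)| <= C2.
  move=> tT xO; apply: le_trans C2ge.
  apply: lerD; first exact: e1b (ooT _ tT) (OO _ xO).
  by apply: le_trans (e2bB _ _ tT xO); rewrite lerDl.
clearbody C1 C2 N J d1 d2 d3 d4 M.
have mom t x v : t \in `[0, T] -> Omega x -> F (t, x, v) != 0 -> enorm v <= k0 + C2 * t.
  apply: (transport_momentum_bound hT fC vlasov Fbd k00 C20 e1e2).
  by move=> y w yO /(Fspt _ _ yO)[].
set Psi := Linfty _ psi_ext.
have Psi0 : 0 <= Psi by exact: Linfty_ge0.
have psi0 x v : Omega x -> F (0, x, v) != 0 -> `|v.2 + psi_ext x| <= k0 + Psi.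
  move=> xO Fn0; have [_ vk] := Fspt _ _ xO Fn0.
  (* [f] stays nonzero near [x], so the support contains a neighbourhood of [x] *)
  have nx : nbhs x `[eps0, 1 - eps0]%classic.
    have cx : {for x, continuous (fun y => F (0, y, v))}.
      suff: continuous (fun y => F (0, y, v)) by apply.
      by cts.
    have nz : nbhs x [set y | F (0, y, v) != 0] by exact: cvgr_neq0 cx Fn0.
    apply: filterS (filterI (nbdO _ xO) nz) => y [yO yn0].
    by have [] := Fspt _ _ yO yn0.
  have := nbhs_singleton nx; rewrite /= in_itv/= => /andP[x1 x2].
  have px : `|psi_ext x| <= Psi.
    apply: (Linfty_itv_ge (a := eps0) (b := 1 - eps0)) => //; first exact: le_trans x1 x2.
    have [cp _ _] := hpsi; apply: continuous_subspaceW cp => y.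
    rewrite /= in_itv/= => /andP[y1 y2]; rewrite /Omega /= in_itv/=.
    by rewrite (lt_le_trans heps0 y1) (le_lt_trans y2)// ltrBlDr ltrDl.
  apply: le_trans (ler_normD _ _) _; apply: lerD => //.
  exact: le_trans (ler_enorm2 v) vk.
have can t x v : t \in `[0, T] -> Omega x -> F (t, x, v) != 0 ->
    `|v.2 + psi_ext x| <= k0 + Psi + 3 * C1 * t.
  move=> tT xO Fn0.
  have C30 : 0 <= 3 * C1 by rewrite mulr_ge0.
  have H sg : sg ^+ 2 = 1 -> (forall y : R, sg * y <= `|y|) ->
      sg * (v.2 + psi_ext x) <= k0 + Psi + 3 * C1 * t.
    move=> s1 sn.
    apply: (transport_canonical_momentum hT fC vlasov Fbd Fsupp dpsi s1 C30 e2bB) => //.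
    by move=> y w yO wn0; apply: le_trans (sn _) _; exact: psi0.
  rewrite ler_norml lerNl; apply/andP; split.
    by rewrite -mulN1r; apply: H => [|y]; rewrite ?sqrrN ?expr1n// mulN1r -normrN ler_norm.
  by rewrite -[_ + _ in leLHS]mul1r; apply: H => [|y]; rewrite ?expr1n// mul1r ler_norm.
clearbody Psi; move=> t tT; split.
  apply: ge_ereal_sup => _ [v [x xO fn0] <-]; rewrite lee_fin.
  by apply: (mom _ _ _ tT xO); rewrite FE//; exact: OO.
have t0 : 0 <= t by move: tT; rewrite in_itv/= => /andP[].
set S := 2 * k0 + C1 + 3 * C2 * t + Psi.
have S0 : 0 <= S by rewrite /S !addr_ge0 ?mulr_ge0.
have -> : c0^-1 + 2 * k0 + C1 + 3 * C2 * t + Psi = c0^-1 + S by rewrite /S; ring.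
have cS : 0 < c0^-1 + S by rewrite ltr_wpDr// invr_gt0.
(* a point is close to the walls only if [psi_ext] is large there *)
apply: dist_bd_lower => // [|x [xO [v fn0]]]; first exact: divr_gt0.
have [r r0 rE] := edist_inf_Omega xO; exists r => //; split => //.
have Fn0 : F (t, x, v) != 0 by rewrite (FE _ _ _ tT (OO _ xO)).
have pS : `|psi_ext x| <= S.
  have h1 := mom _ _ _ tT xO Fn0; have h2 := can _ _ _ tT xO Fn0.
  have h3 := ler_enorm2 v; have h4 := ler_normB (v.2 + psi_ext x) v.2.
  rewrite [v.2 + _]addrC addrK in h4.
  apply: le_trans h4 _; rewrite [psi_ext x + _]addrC.
  apply: le_trans (lerD h2 (le_trans h3 h1)) _.
  rewrite -subr_ge0 (_ : _ - _ = C1 + (C2 - 3 * C1) * t + C2 * t); last by rewrite /S; ring.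
  by rewrite !addr_ge0// mulr_ge0// subr_ge0.
have := hpsi_lb _ xO; rewrite rE poweR_EFin -EFinM -EFinB lee_fin powRN lerBlDr => h.
have rg : 0 < r `^ gamma by exact: powR_gt0.
rewrite ler_pdivrMr// mulrC -ler_pdivrMr// addrC.
by apply: le_trans h _; rewrite lerD2r.
Qed.
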